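(* Let $\mathrm{M}$ be a matroid (on a finite ground set) of rank $r\ge 1$, and write its reduced characteristic polynomial as $\overline{\chi}_{\mathrm{M}}(t)=\sum_{k=0}^{r-1}c_kt^k$. Then the sequence $|c_0|,|c_1|,\ldots,|c_{r-1}|$ of absolute values of its coefficients is log-concave, i.e. $|c_k|^2\ge|c_{k-1}|\,|c_{k+1}|$ for all $0<k<r-1$.
   Context: Let $\mathscr{L}(\mathrm{M})$ be the lattice of flats of $\mathrm{M}$ ordered by inclusion, $E$ the ground set (the largest flat), $\hat 0$ the smallest flat (equal to $\varnothing$ when $\mathrm{M}$ has no loops), $\mu$ the Möbius function of $\mathscr{L}(\mathrm{M})$, and $r(F,E)$ the rank (length of a maximal chain) of the interval $[F,E]$ in $\mathscr{L}(\mathrm{M})$. The characteristic polynomial is $\chi_{\mathrm{M}}(t)=\sum_{F\in\mathscr{L}(\mathrm{M})}\mu(\hat 0,F)\,t^{r(F,E)}$. If $\mathrm{M}$ has rank at least one, $\chi_{\mathrm{M}}(t)$ is divisible by $t-1$, and the reduced characteristic polynomial is $\overline{\chi}_{\mathrm{M}}(t)=\chi_{\mathrm{M}}(t)/(t-1)$, a polynomial of degree $r-1$. *)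

(* Defs.v *)
From HB Require Import structures.
From mathcomp Require Import all_boot all_order all_algebra.

Set Implicit Arguments.
Unset Strict Implicit.
Unset Printing Implicit Defensive.

Import Order.TTheory GRing.Theory Num.Theory.

Section Poset.
Local Open Scope order_scope.
Variables (d : Order.disp_t) (P : finPOrderType d).

(* [n] is fuel: any [n] at least the number of elements below [y] gives the
   same value, by [mobius_rec_fuel]. *)
Fixpoint mobius_rec (n : nat) (x y : P) : int :=
  if x == y then 1%R else
  if n is n'.+1 then
    if x < y then (- \sum_(z : P | (x <= z < y)%O) mobius_rec n' x z)%R
    else 0%R
  else 0%R.

Definition mobius (x y : P) : int := mobius_rec #|P| x y.

Lemma mobius_rec_fuel (n m : nat) (x y : P) :
    (#|[pred z | (z < y)%O]| <= n)%N -> (#|[pred z | (z < y)%O]| <= m)%N ->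
  mobius_rec n x y = mobius_rec m x y.
Proof.
elim: n m y => [|n IHn] [|m] y //=.
- move=> n0 _; case: eqP => // _; case: ifP => // xy.
  by move: n0; rewrite leqn0 => /eqP/card0_eq/(_ x); rewrite inE xy.
- move=> _ n0; case: eqP => // _; case: ifP => // xy.
  by move: n0; rewrite leqn0 => /eqP/card0_eq/(_ x); rewrite inE xy.
move=> hn hm; case: eqP => // _; case: ifP => // xy; congr (- _)%R.
apply: eq_bigr => z /andP[_ zy].
have lt_zy : (#|[pred t | (t < z)%O]| < #|[pred t | (t < y)%O]|)%N.
  apply: proper_card; apply/properP; split.
    by apply/subsetP => t; rewrite !inE => /lt_trans; apply.
  by exists z; rewrite !inE ?ltxx.
by apply: IHn; rewrite -ltnS; [exact: leq_trans hn | exact: leq_trans hm].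
Qed.

Lemma mobiusxx (x : P) : mobius x x = 1%R.
Proof. by rewrite /mobius; case: #|P| => [|n] /=; rewrite eqxx. Qed.

Lemma mobius_lt (x y : P) : x < y ->
  mobius x y = (- \sum_(z : P | (x <= z < y)%O) mobius x z)%R.
Proof.
move=> xy; have : (0 < #|P|)%N by apply/card_gt0P; exists x.
rewrite /mobius; case cP: #|P| => [//|n] _.
rewrite [LHS]/= (lt_eqF xy) xy; congr (- _)%R; apply: eq_bigr => z /andP[_ zy].
have hz : (#|[pred t | (t < z)%O]| <= n)%N.
  rewrite -ltnS -cP; apply: proper_card; apply/properP.
  split; first exact/subsetP.
  by exists z; rewrite !inE ?ltxx.
by apply: mobius_rec_fuel => //; exact: leqW.
Qed.

Lemma mobius_nle (x y : P) : ~~ (x <= y) -> mobius x y = 0%R.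
Proof.
rewrite /mobius => nxy; have nlt : x < y = false.
  by apply: contraNF nxy => /ltW.
have neq : x == y = false by apply: contraNF nxy => /eqP->.
by case: #|P| => [|n] /=; rewrite neq ?nlt.
Qed.

Lemma mobius_sum0 (x y : P) : x < y ->
  (\sum_(z : P | (x <= z <= y)%O) mobius x z)%R = 0%R.
Proof.
move=> xy; rewrite (bigD1 y) ?(ltW xy) ?lexx //=.
rewrite mobius_lt // addrC; apply/eqP; rewrite subr_eq0; apply/eqP.
by apply: eq_bigl => z; rewrite lt_neqAle [(z != y) && _]andbC andbA.
Qed.

Definition is_chain (C : {set P}) : bool :=
  [forall x in C, forall y in C, (x <= y) || (y <= x)].

Definition interval (x y : P) : {set P} := [set z | x <= z <= y].

(* A chain with [k.+1] elements has length [k]; in a graded poset, such as a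
   geometric lattice, all maximal chains of an interval have the same length. *)
Definition interval_rank (x y : P) : nat :=
  (\max_(C : {set P} | is_chain C && (C \subset interval x y)) #|C|.-1)%N.

End Poset.

(* The ground set is all of [T]; loops are allowed. *)
Record matroid (T : finType) := Matroid {
  indep : {set {set T}};
  indep0 : set0 \in indep;
  indep_sub : forall I J : {set T}, J \in indep -> I \subset J -> I \in indep;
  indep_exchange : forall I J : {set T}, I \in indep -> J \in indep ->
    #|I| < #|J| -> exists2 x, x \in J :\: I & x |: I \in indep }.

Section Matroid.
Variables (T : finType) (M : matroid T).
Implicit Types (A B F G I J : {set T}).

Definition mrank_of A : nat := \max_(I in indep M | I \subset A) #|I|.

Definition mrank : nat := mrank_of [set: T].

Definition is_flat F : bool :=
  [forall x, (x \notin F) ==> (mrank_of F < mrank_of (x |: F))].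

Definition mclosure A : {set T} := \bigcap_(F | is_flat F && (A \subset F)) F.

Lemma leq_mrank_of I A : I \in indep M -> I \subset A -> #|I| <= mrank_of A.
Proof. by move=> iI sIA; apply: (bigop.bigmax_sup I); rewrite ?iI. Qed.

Lemma mrank_ofP A :
  exists2 I, (I \in indep M) && (I \subset A) & #|I| = mrank_of A.
Proof.
rewrite /mrank_of (bigop.bigmax_eq_arg set0) ?indep0 ?sub0set //.
by case: arg_maxnP => [|I iI _]; [rewrite indep0 sub0set | exists I].
Qed.

Lemma indep_extend I A : I \in indep M -> I \subset A ->
  exists J, [/\ J \in indep M, I \subset J, J \subset A & #|J| = mrank_of A].
Proof.
have [n] := ubnP (mrank_of A - #|I|); elim: n I => // n IHn I hn iI sIA.
have [|ltIA] := leqP (mrank_of A) #|I|.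
  by exists I; split=> //; apply/eqP; rewrite eqn_leq leq_mrank_of.
have [K /andP[iK sKA] cK] := mrank_ofP A.
have [|x /setDP[xK xI] ixI] := indep_exchange iI iK; first by rewrite cK.
have [||| J [iJ sJ sJA cJ]] := IHn (x |: I) => //.
- by rewrite cardsU1 xI add1n; apply: leq_trans (ltn_sub2l ltIA _) hn.
- by rewrite subUset sub1set (subsetP sKA).
by exists J; split=> //; apply: subset_trans sJ; apply: subsetUr.
Qed.

Lemma flat_indepU1 F I x : is_flat F -> I \in indep M -> I \subset F ->
  x \notin F -> x |: I \in indep M.
Proof.
move=> /forallP/(_ x)/implyP fF iI sIF xF; have {fF} ltF := fF xF.
have [J [iJ sIJ sJF cJ]] := indep_extend iI sIF.
have [K /andP[iK sK] cK] := mrank_ofP (x |: F).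
have [|y /setDP[yK yJ] iyJ] := indep_exchange iJ iK; first by rewrite cK cJ.
move/subsetP/(_ y yK): (sK); rewrite !inE => /orP[/eqP eyx|yF].
  by apply: indep_sub iyJ _; rewrite eyx setUS.
have : #|y |: J| <= mrank_of F.
  by apply: leq_mrank_of => //; rewrite subUset sub1set yF.
by rewrite cardsU1 yJ cJ add1n ltnn.
Qed.

Lemma flatT : is_flat [set: T].
Proof. by apply/forallP => x; rewrite inE. Qed.

Lemma flatI F G : is_flat F -> is_flat G -> is_flat (F :&: G).
Proof.
move=> fF fG; apply/forallP => x; apply/implyP => xFG.
have [I /andP[iI sI] <-] := mrank_ofP (F :&: G).
have xI : x \notin I by apply: contra xFG; apply: (subsetP sI).
have sIF := subset_trans sI (subsetIl F G).
have sIG := subset_trans sI (subsetIr F G).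
have -> : #|I|.+1 = #|x |: I| by rewrite cardsU1 xI.
apply: leq_mrank_of; last exact: setUS.
by move: xFG; rewrite inE negb_and => /orP[];
  [apply: flat_indepU1 fF _ _ | apply: flat_indepU1 fG _ _].
Qed.

Lemma mclosure_flat A : is_flat (mclosure A).
Proof.
by apply: (big_ind is_flat); [exact: flatT | exact: flatI | move=> F /andP[]].
Qed.

Lemma mclosure_sub A F : is_flat F -> (mclosure A \subset F) = (A \subset F).
Proof.
move=> fF; apply/idP/idP => [|sAF]; last by apply: bigcap_inf; rewrite fF.
by apply: subset_trans; apply/bigcapsP => G /andP[].
Qed.

Record flat : Type := Flat { flat_set :> {set T}; flatP : is_flat flat_set }.

HB.instance Definition _ := [isSub for flat_set].
HB.instance Definition _ := [Finite of flat by <:].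

End Matroid.

Fact flat_display : Order.disp_t. Proof. exact: Order.Disp tt tt. Qed.

Section FlatLattice.
Variables (T : finType) (M : matroid T).
Implicit Types F G H : flat M.

Definition flat_le F G : bool := F \subset G.

Definition flat_meet F G : flat M := Flat (flatI (flatP F) (flatP G)).

Definition flat_join F G : flat M := Flat (mclosure_flat M (F :|: G)).

Fact flat_le_refl : reflexive flat_le.
Proof. by move=> F; apply: subxx. Qed.

Fact flat_le_anti : antisymmetric flat_le.
Proof. by move=> F G sFG; apply/val_inj/eqP; rewrite eqEsubset. Qed.

Fact flat_le_trans : transitive flat_le.
Proof. by move=> G F H; apply: subset_trans. Qed.

HB.instance Definition _ := Order.Le_isPOrder.Build flat_display (flat M)
  flat_le_refl flat_le_anti flat_le_trans.

Fact flat_lexI F G H : (F <= flat_meet G H)%O = (F <= G)%O && (F <= H)%O.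
Proof. exact: subsetI. Qed.

Fact flat_leUx F G H : (flat_join F G <= H)%O = (F <= H)%O && (G <= H)%O.
Proof. by rewrite -subUset; apply/mclosure_sub/flatP. Qed.

HB.instance Definition _ := Order.POrder_MeetJoin_isLattice.Build
  flat_display (flat M) flat_lexI flat_leUx.

Fact flat_le0x F : (Flat (mclosure_flat M set0) <= F)%O.
Proof. by apply: bigcap_inf; rewrite flatP sub0set. Qed.

Fact flat_lex1 F : (F <= Flat (flatT M))%O.
Proof. exact: subsetT. Qed.

HB.instance Definition _ :=
  Order.hasBottom.Build flat_display (flat M) flat_le0x.

HB.instance Definition _ :=
  Order.hasTop.Build flat_display (flat M) flat_lex1.

Lemma flat_leE F G : (F <= G)%O = (F \subset G).
Proof. by []. Qed.

Lemma flat_top : (\top%O : flat M) = [set: T] :> {set T}.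
Proof. by []. Qed.

Lemma flat_bottom :
  (\bot%O : flat M) = [set x | [set x] \notin indep M] :> {set T}.
Proof.
have fL : is_flat M [set x | [set x] \notin indep M].
  apply/forallP => x; apply/implyP; rewrite inE negbK => ix.
  have -> : mrank_of M [set x | [set x] \notin indep M] = 0.
    have [I /andP[iI /subsetP sI] <-] :=
      mrank_ofP M [set x | [set x] \notin indep M].
    apply/eqP; rewrite cards_eq0; apply/set0Pn => -[y yI].
    have := sI _ yI; rewrite inE => /negP[].
    by apply: indep_sub iI _; rewrite sub1set.
  by rewrite -(cards1 x) leq_mrank_of ?subsetUl.
apply/eqP; rewrite eqEsubset; apply/andP; split.
  by have := mclosure_sub set0 fL; rewrite sub0set.
apply/subsetP => x; rewrite inE; apply: contraR => xb.
rewrite -[[set x]]setU0.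
by apply: flat_indepU1 (flatP (\bot%O : flat M)) (indep0 M) _ xb;
  exact: sub0set.
Qed.

Lemma flat_bottom_loopless :
  (forall x, [set x] \in indep M) -> (\bot%O : flat M) = set0 :> {set T}.
Proof. by move=> iM; rewrite flat_bottom; apply/setP => x; rewrite !inE iM. Qed.

Lemma flat_bottom_lt_top : 0 < mrank M -> (\bot < \top :> flat M)%O.
Proof.
move=> rM; rewrite lt_neqAle le0x andbT; apply/eqP => bt.
have [I /andP[iI _] cI] := mrank_ofP M [set: T].
have /card_gt0P[x xI] : 0 < #|I| by rewrite cI.
have : x \in (\bot%O : flat M) by rewrite bt flat_top inE.
rewrite flat_bottom inE => /negP[].
by apply: indep_sub iI _; rewrite sub1set.
Qed.

End FlatLattice.

Section CharPoly.
Variables (T : finType) (M : matroid T).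
Local Open Scope ring_scope.

Definition characteristic_poly : {poly int} :=
  \sum_(F : flat M) mobius \bot%O F *: 'X^(interval_rank F \top%O).

(* [%/] on {poly int} is a pseudo-division; as ['X - 1] is monic it needs no
   scaling, and it is exact when the rank is positive (next lemma). *)
Definition reduced_characteristic_poly : {poly int} :=
  characteristic_poly %/ ('X - 1).

Lemma reduced_characteristic_polyK : (0 < mrank M)%N ->
  reduced_characteristic_poly * ('X - 1) = characteristic_poly.
Proof.
move=> rM; apply: Pdiv.IdomainUnit.divpK.
  by rewrite lead_coefXsubC unitr1.
rewrite -polyC1 dvdp_XsubCl /root /characteristic_poly horner_sum.
rewrite -[X in _ == X](mobius_sum0 (flat_bottom_lt_top rM)); apply/eqP.
by apply: eq_big => F; rewrite ?le0x ?lex1 // !hornerE expr1n mulr1.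
Qed.

End CharPoly.

(* Main.v *)
(** The proof follows the Lorentzian approach of Brändén and Leake, on maximal
    flags of flats.  A function [v] on flats, considered modulo the affine
    functions [F |-> c + sum_(i in F) y_i], acts on a flag by interpolating it
    affinely along the flag and summing the defects over the flats which
    refine the flag.  Iterating this until the flag is full gives a number
    [deg [:: v1; ..; vm] S]; it is multilinear and symmetric because the Bergman
    fan is balanced.  If every [vi] is locally convex, the form
    [(x, y) |-> deg (x :: y :: vs) S] has at most one positive direction: in
    codimension 2 this is a direct computation, and it propagates upwards
    since the links are connected (Bochner's method).  Hence
    [deg (a :: b :: vs) S ^ 2 >= deg (a :: a :: vs) S * deg (b :: b :: vs) S].
    For [alpha = - 1_top] and [beta = - 1_bot], Weisner's theorem shows that
    the degree of [beta ^ (r - 1 - k) * alpha ^ k] on the flag [bot < top] is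
    the absolute value of the coefficient [c_k]. *)

Require Import Defs.
From mathcomp Require Import all_boot all_order all_algebra ring lra zify.

Set Implicit Arguments.
Unset Strict Implicit.
Unset Printing Implicit Defensive.

Import Order.TTheory GRing.Theory Num.Theory.
Local Open Scope ring_scope.

(** * The Bochner method *)

(** The obstacle is that [alpha] and [beta] are only weakly convex, while the positivity of degrees
    and the induction over links both require strict convexity. Every argument is therefore
    perturbed to [v + e ** c], where [c] is the strictly convex function [neg_card_sq]. Degrees are
    polynomials in [e], so the case [e = 0] is recovered algebraically, and the whole argument for
    matroids takes place over [rat]. The vertices bottom and top belong to every flag. A full flag
    thus has r + 1 members, the flag bot < top takes r - 1 functions, and affine functions can be
    normalised to vanish at both ends. *)

(** The columns of [cokermx A] lie in the kernel of the matrix, so the hypothesis is the criterion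
    [submxE] for [x] to be in the row space. In [bochner] it solves a singular self-adjoint
    system. *)
Lemma fredholm_alternative (R : fieldType) (I : finType) (c : I -> I -> R)
    (x : I -> R) :
    (forall z : I -> R, (forall i, \sum_j c i j * z j = 0) ->
       \sum_i x i * z i = 0) ->
  exists y : I -> R, forall j, \sum_i y i * c i j = x j.
Proof.
move=> xker; pose A := \matrix_(i < #|I|, j < #|I|) c (enum_val i) (enum_val j).
pose v := \row_(i < #|I|) x (enum_val i).
have sumI (f : I -> R) : \sum_i f i = \sum_(i < #|I|) f (enum_val i).
  by rewrite (reindex _ (onW_bij _ (enum_val_bij I))).
have /submxP[y vE] : (v <= A)%MS.
  rewrite submxE; apply/eqP/rowP => k; rewrite mxE [RHS]mxE.
  have -> : \sum_j v 0 j * cokermx A j k =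
      \sum_i x i * cokermx A (enum_rank i) k.
    by rewrite sumI; apply: eq_bigr => i _; rewrite [v _ _]mxE enum_valK.
  apply: xker => i.
  have /matrixP/(_ (enum_rank i) k) := mulmx_coker A.
  rewrite mxE [RHS]mxE => Ai; rewrite sumI -[RHS]Ai; apply: eq_bigr => j _.
  by rewrite [A _ _]mxE enum_rankK enum_valK.
exists (fun i => y 0 (enum_rank i)) => j.
have /rowP/(_ (enum_rank j)) := vE; rewrite !mxE enum_rankK => ->.
by rewrite sumI; apply: eq_bigr => i _; rewrite !mxE !enum_valK enum_rankK.
Qed.

(* A substitute for the spectral theorem and Perron-Frobenius: the hypotheses
   say that [T = q^-1 c] is self-adjoint for the weights [q], that
   [1 - T >= 0] with kernel the constants, and that [T ^ 2 >= T].  On the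
   complement of the constants one solves [(1 - T) y = x] and compares
   [<x, x>] with [<x, (1 - T) x>] by Cauchy-Schwarz. *)
Lemma bochner (R : realFieldType) (I : finType) (L : {set I})
    (c : I -> I -> R) (x : I -> R) (q := fun i => \sum_j c i j) :
    (forall i j, c i j = c j i) -> (forall i j, i != j -> 0 <= c i j) ->
    (forall i j, i \notin L -> c i j = 0) -> (forall i, i \in L -> 0 < q i) ->
    (forall f : I -> R, (forall i j, c i j != 0 -> f i = f j) ->
       {in L &, forall i j, f i = f j}) ->
    (forall y : I -> R, \sum_i \sum_j c i j * y i * y j <=
       \sum_(i in L) (\sum_j c i j * y j) ^+ 2 / q i) ->
    \sum_i q i * x i = 0 ->
  \sum_i \sum_j c i j * x i * x j <= 0.
Proof.
move=> csym cpos c0 qpos conn hyp qx.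
pose N (y z : I -> R) := \sum_i q i * y i * z i -
  \sum_i \sum_j c i j * y i * z j.
have q0 i : i \notin L -> q i = 0 by move=> iL; rewrite /q big1 // => j _;
  exact: c0.
(* This is the Dirichlet form of [1 - T]: since [q] is the row sum of [c], the diagonal entries of
   [c] cancel, and their sign is free. *)
have NE y z : N y z *+ 2 = \sum_i \sum_j c i j * (y i - y j) * (z i - z j).
  have E1 : \sum_i q i * y i * z i = \sum_i \sum_j c i j * y i * z i.
    by apply: eq_bigr => i _; rewrite /q -mulrA mulr_suml; apply: eq_bigr =>
      j _; rewrite mulrA.
  have E2 : \sum_i \sum_j c i j * y i * z i = \sum_i \sum_j c i j * y j * z j.
    by rewrite exchange_big; apply: eq_bigr => i _; apply: eq_bigr => j _;
      rewrite csym.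
  have E3 : \sum_i \sum_j c i j * y i * z j = \sum_i \sum_j c i j * y j * z i.
    by rewrite exchange_big; apply: eq_bigr => i _; apply: eq_bigr => j _;
      rewrite csym.
  rewrite mulr2n /N {1}E1 {1}E3 (etrans E1 E2) addrACA -opprD.
  rewrite -!big_split -sumrB; apply: eq_bigr => i _ /=.
  by rewrite -!big_split -sumrB; apply: eq_bigr => j _ /=; ring.
have Nge0 y : 0 <= N y y.
  rewrite -(pmulrn_lge0 _ (ltn0Sn 1)) NE.
  apply: sumr_ge0 => i _; apply: sumr_ge0 => j _.
  have [->|ij] := eqVneq i j; first by rewrite subrr !mulr0.
  by rewrite -mulrA -expr2 mulr_ge0 ?sqr_ge0 // cpos.
have NC y z : N y z = N z y.
  suff : N y z *+ 2 = N z y *+ 2 by rewrite !mulr2n => h; lra.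
  by rewrite !NE; apply: eq_bigr => i _; apply: eq_bigr => j _; ring.
have Nlin a y z w : N (fun i => y i + a * z i) w = N y w + a * N z w.
  rewrite /N mulrBr addrACA -opprD !mulr_sumr -!big_split /=; congr (_ - _).
    by apply: eq_bigr => i _; ring.
  apply: eq_bigr => i _; rewrite mulr_sumr -big_split /=.
  by apply: eq_bigr => j _; ring.
have NCS y z : N y z ^+ 2 <= N y y * N z z.
  have quad a : 0 <= N y y + 2 * a * N y z + a ^+ 2 * N z z.
    have := Nge0 (fun i => y i + a * z i).
    rewrite Nlin [N y _]NC [N z (fun _ => _)]NC !Nlin (NC z y).
    by rewrite (_ : _ + _ = N y y + 2 * a * N y z + a ^+ 2 * N z z) //; ring.
  have [z0|zn0] := eqVneq (N z z) 0.
    have [->|yz] := eqVneq (N y z) 0; first by rewrite z0 mulr0 expr0n.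
    (* With [N z z = 0] the expression [quad] is linear in [a], and at this [a] it equals -1. *)
    have := quad (- (N y y + 1) / (2 * N y z)).
    rewrite z0 mulr0 addr0.
    have -> : 2 * (- (N y y + 1) / (2 * N y z)) * N y z = - (N y y + 1).
      by field.
    by move=> h; lra.
  have zpos : 0 < N z z by rewrite lt_neqAle eq_sym zn0 Nge0.
  have := quad (- N y z / N z z).
  have -> : N y y + 2 * (- N y z / N z z) * N y z +
      (- N y z / N z z) ^+ 2 * N z z
     = (N y y * N z z - N y z ^+ 2) / N z z by field.
  by rewrite pmulr_lge0 ?invr_gt0 // subr_ge0.
have NA y z : N y z = \sum_i z i * (q i * y i - \sum_j c i j * y j).
  rewrite NC /N -sumrB; apply: eq_bigr => i _; rewrite mulrBr; congr (_ - _);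
    first by ring.
  by rewrite mulr_sumr; apply: eq_bigr => j _; ring.
pose A i j := q i * (i == j)%:R - c i j.
have AE (y : I -> R) i : \sum_j A i j * y j = q i * y i - \sum_j c i j * y j.
  rewrite /A (eq_bigr (fun j => q i * (i == j)%:R * y j - c i j * y j));
    last first.
    by move=> j _; rewrite mulrBl.
  rewrite sumrB; congr (_ - _); rewrite (bigD1 i) //= eqxx mulr1.
  by rewrite big1 ?addr0 // => j; rewrite eq_sym => /negPf->;
    rewrite mulr0 mul0r.
have [|y yE] := @fredholm_alternative R I A (fun i => q i * x i).
  move=> z Az; have Nzz : N z z = 0.
    by rewrite NA big1 // => i _; rewrite -AE Az mulr0.
  have zc : {in L &, forall i j, z i = z j}.
    apply: conn => i j cij; apply/eqP; rewrite -subr_eq0.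
    have [->|ij] := eqVneq i j; first by rewrite subrr.
    have t0 i' j' : 0 <= c i' j' * (z i' - z j') * (z i' - z j').
      have [->|ij'] := eqVneq i' j'; first by rewrite subrr !mulr0.
      by rewrite -mulrA -expr2 mulr_ge0 ?sqr_ge0 // cpos.
    have := NE z z; rewrite Nzz mul0rn => /esym/eqP.
    rewrite psumr_eq0 => [|i' _]; last exact: sumr_ge0.
    move=> /allP/(_ i (mem_index_enum _)); rewrite psumr_eq0 //.
    move=> /allP/(_ j (mem_index_enum _)); rewrite -mulrA mulf_eq0
      (negPf cij) /=.
    by rewrite mulf_eq0 orbb.
  have [/eqP L0|[i0 i0L]] := set_0Vmem L.
    by apply: big1 => i _; rewrite q0 ?(eqP L0) ?inE // !mul0r.
  transitivity (z i0 * \sum_i q i * x i); last by rewrite qx mulr0.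
  rewrite mulr_sumr; apply: eq_bigr => i _.
  have [iL|iL] := boolP (i \in L); first by rewrite (zc i i0) //; ring.
  by rewrite q0 // !mul0r mulr0.
have yE' i : q i * y i - \sum_j c i j * y j = q i * x i.
  rewrite -yE -AE; apply: eq_bigr => j _; rewrite mulrC; congr (_ * _).
  rewrite /A csym eq_sym; case: eqP => [->//|_]; by rewrite !mulr0.
pose s := \sum_i q i * x i ^+ 2.
have Nyx : N y x = s.
  by rewrite NA; apply: eq_bigr => i _; rewrite yE'; ring.
have Nyy : N y y = \sum_i q i * x i * y i.
  by rewrite NA; apply: eq_bigr => i _; rewrite yE'; ring.
(* Here [T y = y - x], so [T ^ 2 >= T] evaluated at [y] turns into this bound. *)
have Nyys : N y y <= s.
  have cy i : \sum_j c i j * y j = q i * (y i - x i).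
    by have := yE' i; rewrite mulrBr => h; lra.
  have := hyp y.
  have -> : \sum_i \sum_j c i j * y i * y j = \sum_i q i * (y i - x i) * y i.
    apply: eq_bigr => i _; rewrite -cy mulr_suml.
    by apply: eq_bigr => j _; ring.
  have -> : \sum_(i in L) (\sum_j c i j * y j) ^+ 2 / q i =
      \sum_i q i * (y i - x i) ^+ 2.
    rewrite big_mkcond /=; apply: eq_bigr => i _; case: ifP => [iL|/negbT iL].
      by rewrite cy; field; rewrite gt_eqF // qpos.
    by rewrite q0 // mul0r.
  rewrite -subr_ge0 -sumrB -[N y y <= s]subr_ge0 Nyy /s -sumrB.
  suff -> : \sum_i (q i * (y i - x i) ^+ 2 - q i * (y i - x i) * y i) =
            \sum_i (q i * x i ^+ 2 - q i * x i * y i) by [].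
  by apply: eq_bigr => i _; ring.
have Nxx : N x x = s - \sum_i \sum_j c i j * x i * x j.
  by rewrite /N; congr (_ - _); apply: eq_bigr => i _; ring.
have t0 i : 0 <= q i * x i ^+ 2.
  have [iL|iL] := boolP (i \in L);
    first by rewrite mulr_ge0 ?sqr_ge0 // ltW // qpos.
  by rewrite q0 // mul0r.
have s0 : 0 <= s by exact: sumr_ge0.
have [sz|sn] := eqVneq s 0.
  rewrite big1 // => i _; rewrite big1 // => j _.
  have [iL|iL] := boolP (i \in L); last by rewrite c0 // !mul0r.
  move/eqP: sz; rewrite psumr_eq0 // => /allP/(_ i (mem_index_enum _)) /=.
  rewrite mulf_eq0 gt_eqF ?qpos //= sqrf_eq0 => /eqP->.
  by rewrite mulr0 mul0r.
have sp : 0 < s by rewrite lt_neqAle eq_sym sn.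
have h1 : s ^+ 2 <= s * N x x.
  have := NCS y x; rewrite Nyx => /le_trans; apply.
  by rewrite ler_wpM2r.
by move: h1; rewrite expr2 ler_pM2l // Nxx => h; lra.
Qed.

(** * Degrees on balanced flag complexes *)

(** Replaces the limit as [e] decreases to 0; the bad [e] is explicit, so any ordered field will
    do. *)
Lemma horner0_ge0 (R : realFieldType) (p : {poly R}) :
  (forall e, 0 < e -> 0 <= p.[e]) -> 0 <= p.[0].
Proof.
have [q ->] : exists q, p = q * 'X + p.[0]%:P.
  have /factor_theorem[q pE] : root (p - p.[0]%:P) 0.
    by rewrite /root !hornerE subrr.
  by exists q; rewrite -[p in LHS](subrK p.[0]%:P) pE subr0.
move=> pos; rewrite leNgt; apply/negP => p0.
pose K := \sum_(i < size q) `|q`_i|.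
have K0 : 0 <= K by apply: sumr_ge0.
have qK e : 0 < e -> e <= 1 -> `|q.[e]| <= K.
  move=> e0 e1; rewrite horner_coef (le_trans (ler_norm_sum _ _ _)) //.
  have e0' := ltW e0; apply: ler_sum => i _; rewrite normrM ler_piMr //.
  by rewrite ger0_norm ?exprn_ge0 // exprn_ile1.
move: p0 pos; rewrite !hornerE; set c := p.[0] => c0 pos.
(* Small enough for [q.[e] * e <= - c / 2], which would make [p.[e]] negative. *)
pose e := Num.min 1 (- c / (2 * (K + 1))).
have d0 : 0 < - c / (2 * (K + 1)) by rewrite divr_gt0 ?oppr_gt0 //; lra.
have e0 : 0 < e by rewrite lt_min ltr01.
have e1 : e <= 1 by rewrite ge_min lexx.
have e2 : e * (2 * (K + 1)) <= - c.
  by rewrite -ler_pdivlMr ?ge_min ?lexx ?orbT //; lra.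
have := pos e e0; rewrite !hornerE.
have := qK e e0 e1; rewrite ler_norml => /andP[_ qe].
have : q.[e] * e <= K * e by rewrite ler_wpM2r // ltW.
have : 0 <= K * e by rewrite mulr_ge0 // ltW.
by move: e2; rewrite !mulrDr mulrA; lra.
Qed.

Section FlagComplex.
Local Notation "a ** v" := [ffun F => a * v F] (at level 40).
Variables (R : realFieldType) (V : finType) (flag : pred {set V}) (n : nat).
Variables (lin : {ffun V -> R} -> Prop) (u : {set V} -> V -> {ffun V -> R}).
Implicit Types (v w l : {ffun V -> R}) (vs : seq {ffun V -> R}).
Implicit Types (S : {set V}) (F G : V).

Definition link S := [set F | (F \notin S) && flag (F |: S)].

Definition interp S v := \sum_(F in S) v F ** u S F.

(** The final value 1 is the weight of a full flag, so a degree is meaningful only if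
    [#|S| + size vs = n]; this is why that equation accompanies the lemmas below. It then does not
    depend on the choice of [u], by [deg_interp]. *)
Fixpoint deg vs S : R :=
  if vs is v :: vs' then
    \sum_(F in link S) (v F - interp S v F) * deg vs' (F |: S)
  else 1.

(** Local convexity on a fan: the strict form corresponds to ample classes, the weak form below to
    nef ones. *)
Definition strictly_convex v := forall S, flag S -> exists l,
  [/\ lin l, {in S, l =1 v} & {in link S, forall F, l F < v F}].

Definition weakly_convex v := forall S, flag S -> exists l,
  [/\ lin l, {in S, l =1 v} & {in link S, forall F, l F <= v F}].

Hypothesis lin0 : lin 0.
Hypothesis linP : forall a l1 l2, lin l1 -> lin l2 -> lin (a ** l1 + l2).
Hypothesis flag_convex : forall S S' S'', flag S -> S \subset S' ->
  S' \subset S'' -> flag S'' -> flag S'.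
Hypothesis u_lin : forall S F, flag S -> F \in S -> lin (u S F).
Hypothesis u_dual : forall S F G, flag S -> F \in S -> G \in S ->
  u S F G = (F == G)%:R.
Hypothesis balance1 : forall S l, flag S -> #|S|.+1 = n -> lin l ->
  {in S, forall F, l F = 0} -> \sum_(F in link S) l F = 0.

Lemma linD l1 l2 : lin l1 -> lin l2 -> lin (l1 + l2).
Proof.
move=> h1 h2; rewrite (_ : l1 + l2 = 1 ** l1 + l2); first exact: linP.
by apply/ffunP => F; rewrite !ffunE mul1r.
Qed.

Lemma linZ a l : lin l -> lin (a ** l).
Proof.
move=> h; rewrite (_ : a ** l = a ** l + 0) ?addr0 //.
by rewrite -[finfun _]addr0; exact: linP.
Qed.

Lemma linB l1 l2 : lin l1 -> lin l2 -> lin (l1 - l2).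
Proof.
move=> h1 h2; rewrite (_ : l1 - l2 = (-1) ** l2 + l1); first exact: linP.
by apply/ffunP => F; rewrite !ffunE; ring.
Qed.

Lemma link_notin S F : F \in link S -> F \notin S.
Proof. by rewrite inE => /andP[]. Qed.

Lemma link_flag S F : F \in link S -> flag (F |: S).
Proof. by rewrite inE => /andP[]. Qed.

Lemma card_link S F : F \in link S -> #|F |: S| = #|S|.+1.
Proof. by move=> /link_notin FS; rewrite cardsU1 FS. Qed.

Lemma link_swap S F G : flag S -> F \in link S -> G \in link (F |: S) ->
  (G \in link S) && (F \in link (G |: S)).
Proof.
move=> fS; rewrite !inE negb_or eq_sym => /andP[FS fF] /andP[/andP[nFG GS]].
rewrite setUCA GS negb_or FS nFG /= => fGF; rewrite fGF andbT.
by apply: flag_convex fS _ _ fGF; [exact: subsetUr | exact: subsetUr].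
Qed.

Lemma exchange_link S (f : V -> V -> R) : flag S ->
  \sum_(F in link S) \sum_(G in link (F |: S)) f F G =
  \sum_(G in link S) \sum_(F in link (G |: S)) f F G.
Proof.
move=> fS; rewrite (exchange_big_dep (mem (link S))) => [|F G FS GF] /=.
  apply: eq_bigr => G GS; apply: eq_bigl => F; apply/andP/idP => [[FS GF]|FG].
    by have /andP[] := link_swap fS FS GF.
  by have /andP[] := link_swap fS GS FG.
by have /andP[] := link_swap fS FS GF.
Qed.

Lemma interp_lin S v : flag S -> lin (interp S v).
Proof.
move=> fS; apply: big_rec => // F l FS ll; apply: linP => //.
exact: u_lin.
Qed.

Lemma interpE S v F : flag S -> F \in S -> interp S v F = v F.
Proof.
move=> fS FS; rewrite sum_ffunE (bigD1 F) //= ffunE u_dual // eqxx mulr1.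
rewrite big1 ?addr0 // => G /andP[GS /negPf GF].
by rewrite ffunE u_dual // GF mulr0.
Qed.

Lemma interpD S a v w F :
  interp S (a ** v + w) F = a * interp S v F + interp S w F.
Proof.
rewrite !sum_ffunE mulr_sumr -big_split; apply: eq_bigr => G _ /=.
by rewrite !ffunE; ring.
Qed.

(** The balancing condition of tropical geometry: the degrees by [vs] are the weights of a tropical
    cycle. *)
Definition balanced vs := forall S l, flag S -> (#|S| + (size vs).+1)%N = n ->
  lin l -> {in S, forall F, l F = 0} ->
  \sum_(F in link S) l F * deg vs (F |: S) = 0.

Lemma deg_interp_of_balanced vs v S l : balanced vs -> flag S ->
    (#|S| + (size vs).+1)%N = n -> lin l -> {in S, l =1 v} ->
  deg (v :: vs) S = \sum_(F in link S) (v F - l F) * deg vs (F |: S).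
Proof.
move=> bal fS cS ll lv; apply/eqP; rewrite /= -subr_eq0 -sumrB; apply/eqP.
rewrite -[RHS](bal S (l - interp S v)) //; last first.
- by move=> F FS; rewrite !ffunE interpE // lv // subrr.
- by apply: linB => //; exact: interp_lin.
by apply: eq_bigr => F _; rewrite !ffunE; ring.
Qed.

(** The interpolant on [F |: S] is the one on [S] corrected at [F] alone. This writes the degree of
    two functions as a sum over pairs [F], [G] refining [S]. *)
Lemma deg_cons_link_of_balanced vs w S F : balanced vs -> flag S ->
    (#|S| + (size vs).+2)%N = n -> F \in link S ->
  deg (w :: vs) (F |: S) = \sum_(G in link (F |: S))
    (w G - interp S w G - (w F - interp S w F) * u (F |: S) F G) *
    deg vs (G |: (F |: S)).
Proof.
move=> bal fS cS FS; have fF := link_flag FS; have FF := setU11 F S.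
have SF G : G \in S -> G \in F |: S by move=> GS; rewrite inE GS orbT.
pose l := interp S w + (w F - interp S w F) ** u (F |: S) F.
rewrite (@deg_interp_of_balanced _ _ _ l) //.
- by apply: eq_bigr => G _; rewrite !ffunE; ring.
- by rewrite (card_link FS) -addSnnS in cS *.
- apply: linD; first exact: interp_lin.
  by apply: linZ; apply: u_lin.
move=> G; rewrite in_setU1 => /predU1P[->|GS].
  by rewrite /l !ffunE u_dual // eqxx mulr1 addrC subrK.
rewrite /l !ffunE (interpE _ fS GS) // (u_dual fF FF (SF G GS));
  case: eqP => [FG|_]; last by rewrite mulr0 addr0.
by move: GS; rewrite -FG (negPf (link_notin FS)).
Qed.

(** Induction on [vs]. Expand over pairs and exchange [F] and [G] in the terms with [w G]: the
    coefficient of [w G - interp S w G] becomes the balancing sum at [G |: S] of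
    [l - l G ** u (G |: S) G], which vanishes on [G |: S]. *)
Lemma deg_balanced vs : balanced vs.
Proof.
elim: vs => [|w vs IH] S l fS cS ll l0.
  rewrite (eq_bigr l) => [|F _]; last by rewrite mulr1.
  by apply: balance1 => //; rewrite -cS addn1.
pose d F G := deg vs (G |: (F |: S)).
have dC F G : d F G = d G F by rewrite /d setUCA.
under eq_bigr => F FS do rewrite (deg_cons_link_of_balanced w IH fS cS FS).
rewrite (eq_bigr (fun F =>
  \sum_(G in link (F |: S)) l F * (w G - interp S w G) * d F G -
  \sum_(G in link (F |: S)) l F * (w F - interp S w F) * u (F |: S) F G *
    d F G)).
  rewrite sumrB exchange_link // -sumrB big1 // => G GS.
  have := IH (G |: S) (l - l G ** u (G |: S) G) (link_flag GS).
  rewrite (card_link GS) -[in X in X -> _]cS addSnnS => /(_ erefl) /=.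
  have fG := link_flag GS; have GG := setU11 G S.
  have h1 : lin (l - l G ** u (G |: S) G).
    by apply: linB => //; apply: linZ; apply: u_lin.
  have h2 : {in G |: S, forall F, (l - l G ** u (G |: S) G) F = 0}.
    move=> F; rewrite !ffunE in_setU1 => /predU1P[->|FS].
      by rewrite u_dual // eqxx mulr1 subrr.
    rewrite (u_dual fG GG (setU1r _ FS)) (l0 F FS).
    by case: eqP => [GF|_]; [rewrite GF (l0 F FS) mul0r subrr|
      rewrite mulr0 subrr].
  move=> /(_ h1 h2) IH'; transitivity ((w G - interp S w G) * 0);
    last by rewrite mulr0.
  rewrite -sumrB -[X in _ = _ * X]IH' mulr_sumr; apply: eq_bigr => F _.
  by rewrite dC /d !ffunE; ring.
move=> F _; rewrite -sumrB mulr_sumr; apply: eq_bigr => G _.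
by rewrite /d; ring.
Qed.

Lemma deg_interp vs v S l : flag S ->
    (#|S| + (size vs).+1)%N = n -> lin l -> {in S, l =1 v} ->
  deg (v :: vs) S = \sum_(F in link S) (v F - l F) * deg vs (F |: S).
Proof. exact/deg_interp_of_balanced/deg_balanced. Qed.

(** Expanded over pairs, one double sum is symmetric after exchanging [F] and [G], the other term by
    term. *)
Lemma deg_swap v w vs S : flag S -> (#|S| + (size vs).+2)%N = n ->
  deg (v :: w :: vs) S = deg (w :: v :: vs) S.
Proof.
move=> fS cS; pose d F G := deg vs (G |: (F |: S)).
have dC F G : d F G = d G F by rewrite /d setUCA.
pose r v F := v F - interp S v F.
have E a b : deg (a :: b :: vs) S =
    \sum_(F in link S) \sum_(G in link (F |: S)) r a F * r b G * d F G -
    \sum_(F in link S) \sum_(G in link (F |: S))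
      r a F * r b F * u (F |: S) F G * d F G.
  rewrite -sumrB [LHS]/=; apply: eq_bigr => F FS.
  rewrite -[\sum_(F0 in _) _]/(deg (b :: vs) (F |: S)).
  rewrite deg_cons_link_of_balanced //; last exact: deg_balanced.
  by rewrite -sumrB mulr_sumr; apply: eq_bigr => G _; rewrite /d /r; ring.
rewrite !E; congr (_ - _).
  rewrite exchange_link //; apply: eq_bigr => F _; apply: eq_bigr => G _.
  by rewrite dC; ring.
by apply: eq_bigr => F _; apply: eq_bigr => G _; ring.
Qed.

Lemma deg_front vs1 v vs2 S : flag S -> (#|S| + (size (vs1 ++ vs2)).+1)%N = n ->
  deg (vs1 ++ v :: vs2) S = deg (v :: vs1 ++ vs2) S.
Proof.
elim: vs1 S => [|w vs1 IH] S fS cS //.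
rewrite [RHS]deg_swap //=; apply: eq_bigr => F FS; congr (_ * _).
by apply: IH; rewrite ?link_flag // card_link // addSnnS.
Qed.

Lemma deg_linear a v w vs S :
  deg ((a ** v + w) :: vs) S = a * deg (v :: vs) S + deg (w :: vs) S.
Proof.
rewrite /= mulr_sumr -big_split; apply: eq_bigr => F _ /=.
by rewrite interpD !ffunE; ring.
Qed.

Lemma deg_sum (I : finType) (P : pred I) (a : I -> R)
    (f : I -> {ffun V -> R}) vs S :
  deg ((\sum_(i | P i) a i ** f i) :: vs) S =
  \sum_(i | P i) a i * deg (f i :: vs) S.
Proof.
pose g v := deg (v :: vs) S; rewrite -/(g _).
have g0 : g 0 = 0.
  have := deg_linear 1 0 0 vs S; rewrite (_ : 1 ** (0 : {ffun V -> R}) + 0 = 0)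
    ?/g; first by lra.
  by apply/ffunP => F; rewrite !ffunE mul1r addr0.
have gP b v w : g (b ** v + w) = b * g v + g w by exact: deg_linear.
by elim/big_rec2: _ => [|i _ w _ <-] //; rewrite gP.
Qed.

Hypothesis pure : forall S, flag S -> (#|S| < n)%N -> link S != set0.

Lemma deg_gt0 vs S : flag S -> (#|S| + size vs)%N = n ->
  {in vs, forall v, strictly_convex v} -> 0 < deg vs S.
Proof.
elim: vs S => [|v vs IH] S fS cS vsc; first by rewrite /= ltr01.
have [l [ll lv lt_lv]] := vsc v (mem_head _ _) S fS.
rewrite (deg_interp fS cS ll lv).
have pos F : F \in link S -> 0 < (v F - l F) * deg vs (F |: S).
  move=> FS; rewrite mulr_gt0 ?subr_gt0 ?lt_lv //.
  apply: IH; rewrite ?link_flag ?card_link // ?addSnnS //.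
  by move=> w wvs; apply: vsc; rewrite inE wvs orbT.
have /set0Pn[F0 F0S] : link S != set0.
  by apply: pure => //; rewrite -cS addnS ltnS leq_addr.
rewrite (bigD1 F0) //= ltr_pwDl ?pos // sumr_ge0 // => F /andP[FS _].
exact/ltW/pos.
Qed.

(** Only values on the star of [S] are compared, so a function supported on the link can represent
    [v] at [S]. *)
Lemma deg_mod_lin v v' l vs S : flag S -> (#|S| + (size vs).+1)%N = n ->
    lin l -> {in S :|: link S, forall F, v' F = v F - l F} ->
  deg (v' :: vs) S = deg (v :: vs) S.
Proof.
move=> fS cS ll vv'.
rewrite (@deg_interp _ v _ (interp S v' + l)) //=.
- apply: eq_bigr => F FS; rewrite vv' ?inE ?FS ?orbT; last first.
    by move: FS; rewrite inE => ->; rewrite orbT.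
  by rewrite !ffunE; ring.
- by apply: linD => //; exact: interp_lin.
by move=> F FS; rewrite !ffunE interpE // vv' ?subrK // inE FS.
Qed.

Lemma link_sub S F G : flag S -> F \in link S ->
  G \in (F |: S) :|: link (F |: S) -> G \in S :|: link S.
Proof.
move=> fS FS; rewrite in_setU in_setU1 -orbA => /or3P[/eqP->|GS|GF].
- by rewrite in_setU FS orbT.
- by rewrite in_setU GS.
by rewrite in_setU; have /andP[->] := link_swap fS FS GF; rewrite orbT.
Qed.

Definition delta F : {ffun V -> R} := [ffun G => (G == F)%:R].

(** [delta F] acts as the divisor class of the ray of [F]: multiplying by it restricts the degree to
    the star of [F]. *)
Lemma deg_delta F vs S : flag S -> (#|S| + (size vs).+1)%N = n -> F \notin S ->
  deg (delta F :: vs) S = if F \in link S then deg vs (F |: S) else 0.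
Proof.
move=> fS cS FS; rewrite (@deg_interp _ _ _ 0) //; last first.
  move=> G GS; rewrite !ffunE; case: eqP => // GF.
  by move: GS; rewrite GF (negPf FS).
case: ifP => FL.
  rewrite (bigD1 F) //= big1 => [|G /andP[_ /negPf GF]].
    by rewrite !ffunE eqxx subr0 mul1r addr0.
  by rewrite !ffunE GF subrr mul0r.
apply: big1 => G GL; rewrite !ffunE; case: eqP => [GF|_].
  by rewrite GF FL in GL.
by rewrite subrr mul0r.
Qed.

Hypothesis connected : forall S, flag S -> (#|S| + 3 <= n)%N ->
  forall f : V -> R,
    (forall F G, F \in link S -> G \in link (F |: S) -> f F = f G) ->
  {in link S &, forall F G, f F = f G}.

(** The induction step: the inequality against [w] at codimension one less makes the form at [S]
    nonpositive on the orthogonal complement of [w]. [bochner] is applied to the graph formed by the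
    link of [S], weighted by degrees. *)
Lemma deg_bochner w ws x S :
    (forall y T, flag T -> (#|T| + (size ws).+2)%N = n ->
       deg (y :: y :: ws) T * deg (w :: w :: ws) T <=
       deg (y :: w :: ws) T ^+ 2) ->
    flag S -> (#|S| + (size ws).+3)%N = n ->
    {in w :: ws, forall v, strictly_convex v} ->
    deg (x :: w :: w :: ws) S = 0 ->
  deg (x :: x :: w :: ws) S <= 0.
Proof.
move=> IH fS cS wsc; have [l [ll lw ltw]] := wsc w (mem_head _ _) S fS.
set L := link S in ltw *; pose om F := w F - l F.
have om_gt0 F : F \in L -> 0 < om F by move=> FL; rewrite subr_gt0 ltw.
have cL F : F \in L -> (#|F |: S| + (size ws).+2)%N = n.
  by move=> FL; rewrite card_link // addSnnS.
(* The factor [om] makes the constant 1 represent [w] modulo [l], so that the row sums of [c] are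
   [om F * deg (w :: w :: ws) (F |: S)]. *)
pose hat (y : V -> R) := \sum_(G in L) (y G * om G) ** delta G.
have hatE y F : hat y F = if F \in L then y F * om F else 0.
  rewrite /hat sum_ffunE; case: ifP => FL.
    rewrite (bigD1 F) //= big1 => [|G /andP[_ /negPf GF]].
      by rewrite !ffunE eqxx mulr1 addr0.
    by rewrite !ffunE eq_sym GF mulr0.
  apply: big1 => G GL; rewrite !ffunE; case: eqP => [FG|_];
    last by rewrite mulr0.
  by rewrite -FG FL in GL.
have hat0 y F : F \in S -> hat y F = 0.
  by move=> FS; rewrite hatE; case: ifP => // /link_notin; rewrite FS.
have degH y vs T : deg (hat y :: vs) T =
    \sum_(G in L) y G * om G * deg (delta G :: vs) T by exact: deg_sum.
pose c F G := if (F \in L) && (G \in L) then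
  om F * om G * deg (delta G :: w :: ws) (F |: S) else 0.
have c_hat y F : F \in L ->
    \sum_G c F G * y G = om F * deg (hat y :: w :: ws) (F |: S).
  move=> FL; rewrite degH mulr_sumr big_mkcond [RHS]big_mkcond /=.
  apply: eq_bigr => G _; rewrite /c FL /=; case: ifP => _;
    last by rewrite mul0r.
  by ring.
have B_hat z y : deg (hat z :: hat y :: w :: ws) S =
    \sum_F \sum_G c F G * z F * y G.
  rewrite (@deg_interp _ _ _ 0) //; last first.
    by move=> F FS; rewrite ffunE hat0.
  rewrite big_mkcond /=; apply: eq_bigr => F _; case: ifP => FL; last first.
    by rewrite big1 // => G _; rewrite /c [F \in L]FL !mul0r.
  rewrite hatE [F \in L]FL ffunE subr0 -mulrA -c_hat // mulr_sumr.
  by apply: eq_bigr => G _; ring.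
have B_om a b : deg (a :: b :: w :: ws) S =
    \sum_(F in L) om F * deg (a :: b :: ws) (F |: S).
  rewrite (@deg_front [:: a; b] w) //=.
  by rewrite -[LHS]/(deg (w :: a :: b :: ws) S) (deg_interp fS _ ll lw).
have csym F G : c F G = c G F.
  rewrite /c andbC; case: ifP => // /andP[GL FL]; rewrite [om F * _]mulrC.
  congr (_ * _); have [FS GS] := (link_notin FL, link_notin GL).
  have e := deg_swap (delta F) (delta G) (vs := w :: ws) fS cS.
  by move: e; rewrite !(deg_delta (S := S)) // -/L FL GL.
have c_off F G : F \in L -> G \in L -> F != G -> c F G =
    om F * om G *
    (if G \in link (F |: S) then deg (w :: ws) (G |: (F |: S)) else 0).
  move=> FL GL FG; rewrite /c FL GL deg_delta ?link_flag ?cL //.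
  by rewrite in_setU1 eq_sym negb_or FG link_notin.
have deg2_gt0 F G : F \in L -> G \in link (F |: S) ->
    0 < deg (w :: ws) (G |: (F |: S)).
  move=> FL GF; apply: deg_gt0 => //; first exact: link_flag.
  by rewrite card_link // addSnnS cL.
have c_ge0 F G : F != G -> 0 <= c F G.
  move=> FG; have [/andP[FL GL]|nL] := boolP ((F \in L) && (G \in L));
    last first.
    by rewrite /c (negPf nL).
  rewrite c_off //; apply: mulr_ge0; first by rewrite mulr_ge0 ?ltW ?om_gt0.
  by case: ifP => // GF; apply/ltW/deg2_gt0.
have hat1 F vs : F \in L -> (size vs = (size ws).+1) ->
    deg (hat (fun=> 1) :: vs) (F |: S) = deg (w :: vs) (F |: S).
  move=> FL svs; apply: (@deg_mod_lin _ _ l); rewrite ?link_flag ?svs ?cL //.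
  move=> G /(link_sub fS FL); rewrite in_setU hatE; case: ifP => [_ _|GL].
    by rewrite mul1r.
  by rewrite ?GL orbF => /lw->; rewrite subrr.
pose q F := \sum_G c F G.
have qE F : F \in L -> q F = om F * deg (w :: w :: ws) (F |: S).
  move=> FL; rewrite -hat1 // -c_hat //.
  by apply: eq_bigr => G _; rewrite mulr1.
have degww F : F \in L -> 0 < deg (w :: w :: ws) (F |: S).
  move=> FL; apply: deg_gt0; rewrite ?link_flag ?cL //.
  by move=> v; rewrite !inE => /predU1P[->|vw]; apply: wsc; rewrite inE ?eqxx.
pose y F := (x F - interp S x F) / om F.
have yE F : F \in S :|: L -> hat y F = x F - interp S x F.
  rewrite in_setU hatE; case: ifP => [FL _|_];
    first by rewrite divfK ?gt_eqF ?om_gt0.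
  by rewrite orbF => FS; rewrite interpE // subrr.
have degy vs : (#|S| + (size vs).+1)%N = n ->
    deg (hat y :: vs) S = deg (x :: vs) S.
  by move=> svs; apply: (@deg_mod_lin _ _ (interp S x)) => //;
    exact: interp_lin.
move=> xw; have cS' : (#|S| + (size [:: w, w & ws]).+1)%N = n by rewrite -cS.
have cS'' : (#|S| + (size [:: hat y, w & ws]).+1)%N = n by rewrite -cS.
rewrite -degy // deg_swap // -degy // B_hat.
apply: (@bochner _ _ L) => //.
- by move=> F G FL; rewrite /c (negPf FL).
- by move=> F FL; rewrite -/(q F) qE // mulr_gt0 ?om_gt0 ?degww.
(* Adjacent flats have a nonzero entry of [c], so connectedness of the link is that of the graph. *)
- move=> f fc; apply: connected => //; first by rewrite -cS leq_add2l.
  move=> F G FL GF; have /andP[GL _] := link_swap fS FL GF.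
  apply: fc; have := link_notin GF; rewrite in_setU1 negb_or => /andP[GnF _].
  have FnG : F != G by rewrite eq_sym.
  rewrite c_off // GF; apply: lt0r_neq0.
  by apply: mulr_gt0; [rewrite mulr_gt0 ?om_gt0 | exact: deg2_gt0].
(* The hypothesis [T ^ 2 >= T] is the sum over [F] of the inequalities [IH] at [F |: S]. *)
- move=> z; rewrite -B_hat B_om; apply: ler_sum => F FL.
  rewrite -/(q F) qE // c_hat // expr2 -!mulrA ler_pM2l ?om_gt0 //.
  have := IH (hat z) (F |: S) (link_flag FL) (cL F FL).
  rewrite -ler_pdivlMr ?degww // => /le_trans; apply.
  have h := om_gt0 _ FL; have h' := degww _ FL.
  by rewrite le_eqVlt; apply/orP; left; apply/eqP; field; rewrite !gt_eqF.
(* Orthogonality to the constants is orthogonality of [x] to [w]. *)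
transitivity (deg (hat y :: hat (fun=> 1) :: w :: ws) S).
  rewrite B_hat; apply: eq_bigr => F _; rewrite mulr_suml.
  by apply: eq_bigr => G _; rewrite mulr1.
rewrite deg_swap // (@deg_mod_lin w _ l) //; last first.
  move=> G; rewrite in_setU hatE; case: ifP => [_ _|GL]; first by rewrite mul1r.
  by rewrite ?GL orbF => /lw->; rewrite subrr.
by rewrite deg_swap // degy.
Qed.

Hypothesis lorentz2 : forall S x v, flag S -> (#|S| + 2)%N = n ->
  0 < deg [:: v; v] S ->
  deg [:: x; x] S * deg [:: v; v] S <= deg [:: x; v] S ^+ 2.

(** By [deg_bochner] the form is nonpositive on the orthogonal complement of the head [w] of [ws],
    hence has at most one positive direction; the inequality for [v] follows by projecting along [v]
    onto that complement. *)
Lemma deg_lorentz ws v x S : flag S -> (#|S| + (size ws).+2)%N = n ->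
    {in v :: ws, forall w, strictly_convex w} ->
  deg (x :: x :: ws) S * deg (v :: v :: ws) S <= deg (x :: v :: ws) S ^+ 2.
Proof.
elim: ws v x S => [|w ws IH] v x S fS cS vc.
  apply: lorentz2 => //; apply: deg_gt0 => // w.
  by rewrite !inE orbb => wv; apply: vc; rewrite inE wv.
have vv_gt0 : 0 < deg (v :: v :: w :: ws) S.
  by apply: deg_gt0 => // a; rewrite in_cons => /predU1P[->|]; apply: vc;
    rewrite mem_head.
pose B a b := deg (a :: b :: w :: ws) S.
have BC a b : B a b = B b a by exact: deg_swap.
have Blin k (a b d : {ffun V -> R}) : B (k ** a + b) d = k * B a d + B b d by
  exact: deg_linear.
have BZ k (a d : {ffun V -> R}) : B (k ** a) d = k * B a d.
  have B0 : B 0 d = 0.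
    have := Blin 1 0 0 d; rewrite (_ : 1 ** (0 : {ffun V -> R}) + 0 = 0).
      by lra.
    by apply/ffunP => F; rewrite !ffunE mul1r addr0.
  by rewrite -[k ** a]addr0 Blin B0 addr0.
have neg a : B a w = 0 -> B a a <= 0.
  have wc : {in w :: ws, forall w, strictly_convex w}.
    by move=> a' h; apply: vc; rewrite in_cons h orbT.
  by apply: deg_bochner => // y T fT cT; exact: IH.
(* The combination of [x] and [v] that is orthogonal to [w]. *)
pose y := B v w ** x + (- B x w) ** v.
have yw : B y w = 0 by rewrite /y Blin BZ; ring.
have := neg y yw.
have -> : B y y = B v w ^+ 2 * B x x - 2 * B v w * B x w * B x v +
    B x w ^+ 2 * B v v.
  by rewrite {1}/y Blin BZ ![B _ y]BC /y !Blin !BZ (BC v x); ring.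
have vw_neq0 : B v w != 0.
  by apply: contraTneq vv_gt0 => /neg; rewrite -leNgt.
rewrite -/(B x x) -/(B v v) -/(B x v) => le0.
have vw2 : 0 < B v w ^+ 2 by rewrite exprn_even_gt0.
rewrite -(ler_pM2l vw2) -subr_ge0.
(* [- B v v * B y y] plus the square below is [B v w ^+ 2] times the desired difference. *)
have := mulr_ge0 (ltW vv_gt0) (_ : 0 <= - (B v w ^+ 2 * B x x -
  2 * B v w * B x w * B x v + B x w ^+ 2 * B v v)).
rewrite oppr_ge0 -/(B v v) => /(_ le0) h.
have := addr_ge0 h (sqr_ge0 (B v v * B x w - B x v * B v w)).
by congr (0 <= _); ring.
Qed.

Lemma strictly_convexD v (c : {ffun V -> R}) e : weakly_convex v ->
  strictly_convex c -> 0 < e ->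
  strictly_convex (v + e ** c).
Proof.
move=> vc cc e0 S fS; have [l1 [h1 e1 le1]] := vc S fS.
have [l2 [h2 e2 lt2]] := cc S fS; exists (l1 + e ** l2).
split=> [|F FS|F FS]; first by apply: linD => //; exact: linZ.
  by rewrite !ffunE e1 ?e2.
by rewrite !ffunE ler_ltD ?le1 // ltr_pM2l ?lt2.
Qed.

Lemma deg_poly vs (c : {ffun V -> R}) S :
  exists p : {poly R}, forall e, deg [seq v + e ** c | v <- vs] S = p.[e].
Proof.
elim: vs S => [|v vs IH] S; first by exists 1 => e; rewrite hornerC.
have [q qE] := fin_all_exists (fun F => IH (F |: S)).
exists (\sum_(F in link S)
  ((v F - interp S v F)%:P + (c F - interp S c F) *: 'X) * q F) => e.
rewrite horner_sum /=; apply: eq_bigr => F _.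
by rewrite [v + _]addrC interpD !hornerE -qE !ffunE; ring.
Qed.

Lemma deg_log_concave c vs a b S : strictly_convex c -> weakly_convex b ->
    {in vs, forall v, weakly_convex v} -> flag S ->
    (#|S| + (size vs).+2)%N = n ->
  deg (a :: a :: vs) S * deg (b :: b :: vs) S <= deg (a :: b :: vs) S ^+ 2.
Proof.
move=> cc bc vsc fS cS.
have [p pE] := deg_poly (a :: a :: vs) c S.
have [q qE] := deg_poly (b :: b :: vs) c S.
have [r rE] := deg_poly (a :: b :: vs) c S.
have at0 ws : [seq v + 0 ** c | v <- ws] = ws.
  rewrite -[RHS]map_id; apply: eq_map => v; apply/ffunP => F.
  by rewrite !ffunE mul0r addr0.
have := pE 0; have := qE 0; have := rE 0; rewrite !at0 => -> -> ->.
rewrite -hornerM -horner_exp -subr_ge0 -hornerN -hornerD.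
apply: horner0_ge0 => e e0; rewrite !hornerE subr_ge0 -pE -qE -rE.
apply: deg_lorentz; rewrite ?size_map //= => v.
rewrite in_cons => /predU1P[->|/mapP[w wvs ->]]; first exact: strictly_convexD.
by apply: strictly_convexD => //; exact: vsc.
Qed.

End FlagComplex.

(** * Flags of flats *)

Section Rank.
Local Open Scope nat_scope.
Variables (T : finType) (M : matroid T).
Implicit Types (A B : {set T}) (F G H : flat M) (S : {set flat M}) (x : T).

Local Notation rk F := (mrank_of M (flat_set F)).

Lemma mrank_ofS A B : A \subset B -> mrank_of M A <= mrank_of M B.
Proof.
have [I /andP[iI sI] <-] := mrank_ofP M A => sAB.
exact/leq_mrank_of/(subset_trans sI).
Qed.

Lemma mrank_ofU1 x A : mrank_of M (x |: A) <= (mrank_of M A).+1.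
Proof.
have [I /andP[iI sI] <-] := mrank_ofP M (x |: A).
have : #|I :\ x| <= mrank_of M A.
  apply: leq_mrank_of; first by apply: indep_sub iI _; exact: subD1set.
  by rewrite subDset.
by rewrite (cardsD1 x I); case: (x \in I) => ?; rewrite ?add1n ?add0n // leqW.
Qed.

(** A maximal superset of [A] with the same rank is a flat, so it contains the closure. *)
Lemma mrank_mclosure A : mrank_of M (mclosure M A) = mrank_of M A.
Proof.
apply/eqP; rewrite eqn_leq [X in _ && X]mrank_ofS ?andbT; last first.
  by rewrite -(mclosure_sub _ (mclosure_flat M A)).
pose P B := (A \subset B) && (mrank_of M B == mrank_of M A).
have [B /maxsetP[/andP[sAB /eqP rB] maxB] _] : {B | maxset P B & A \subset B}.
  by apply: maxset_exists; rewrite /P subxx eqxx.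
rewrite -rB mrank_ofS // mclosure_sub //.
apply/forallP => x; apply/implyP => xB; rewrite ltn_neqAle mrank_ofS ?subsetUr
  //.
rewrite andbT; apply: contra xB => /eqP e.
have <- : x |: B = B; last exact: setU11.
apply: maxB; last exact: subsetUr.
by rewrite /P -e rB eqxx andbT (subset_trans sAB) // subsetUr.
Qed.

Lemma flat_le_rk F G : (F <= G)%O -> rk F <= rk G.
Proof. exact: mrank_ofS. Qed.

Lemma flat_ltP F G : (F < G)%O -> exists2 x, x \in G & x \notin F.
Proof.
move=> FG; have : F \proper G.
  rewrite properEneq -flat_leE (ltW FG) andbT.
  by apply: contraTneq FG => /val_inj->; rewrite ltxx.
by case/properP => _ [x xG xF]; exists x.
Qed.

Lemma flat_lt_rk F G : (F < G)%O -> rk F < rk G.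
Proof.
move=> FG; have [x xG xF] := flat_ltP FG.
have /forallP/(_ x)/implyP/(_ xF) := flatP F => /leq_trans; apply.
by rewrite mrank_ofS // subUset sub1set xG -flat_leE ltW.
Qed.

Lemma flat_le_rk_eq F G : (F <= G)%O -> rk G <= rk F -> F = G.
Proof.
rewrite le_eqVlt => /predU1P[//|/flat_lt_rk]; by rewrite ltnNge => /negPf->.
Qed.

(** Every cover of [F] arises in this way from any of its points outside [F] ([clU_unique]), so the
    covers partition the complement of [F]. *)
Definition clU F x : flat M := Flat (mclosure_flat M (x |: F)).

Lemma clU_le F x G : (clU F x <= G)%O = (x \in G) && (F <= G)%O.
Proof.
by rewrite flat_leE mclosure_sub ?flatP // subUset sub1set.
Qed.

Lemma le_clU F x : (F <= clU F x)%O.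
Proof. by have := lexx (clU F x); rewrite clU_le => /andP[]. Qed.

Lemma in_clU F x : x \in clU F x.
Proof. by have := lexx (clU F x); rewrite clU_le => /andP[]. Qed.

Lemma rk_clU F x : x \notin F -> rk (clU F x) = (rk F).+1.
Proof.
move=> xF; rewrite /= mrank_mclosure; apply/eqP; rewrite eqn_leq mrank_ofU1.
by have /forallP/(_ x)/implyP/(_ xF) := flatP F.
Qed.

Lemma lt_clU F x : x \notin F -> (F < clU F x)%O.
Proof.
move=> xF; rewrite lt_neqAle le_clU andbT; apply: contraNneq xF => {1}->.
exact: in_clU.
Qed.

Lemma clU_unique F G x : (F <= G)%O -> x \in G -> x \notin F ->
  rk G = (rk F).+1 -> G = clU F x.
Proof.
move=> FG xG xF rG; apply/esym/flat_le_rk_eq; first by rewrite clU_le xG.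
by rewrite rG rk_clU.
Qed.

Lemma rk_bot : rk (\bot%O : flat M) = 0.
Proof.
rewrite [flat_set _]/(mclosure M set0) mrank_mclosure.
have [I /andP[_]] := mrank_ofP M set0.
by rewrite subset0 => /eqP->; rewrite cards0.
Qed.

Lemma rk_top : rk (\top%O : flat M) = mrank M.
Proof. by []. Qed.

Lemma rk_le F : rk F <= mrank M.
Proof. by rewrite -rk_top flat_le_rk // lex1. Qed.

Lemma lt_bot_rk F : (\bot < F)%O = (0 < rk F).
Proof.
apply/idP/idP => [/flat_lt_rk|]; first by rewrite rk_bot.
by rewrite lt_def le0x andbT; apply: contraTneq => ->; rewrite rk_bot.
Qed.

Lemma lt_top_rk F : (F < \top)%O = (rk F < mrank M).
Proof.
apply/idP/idP => [/flat_lt_rk|]; first by rewrite rk_top.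
by rewrite lt_neqAle lex1 andbT; apply: contraTneq => ->; rewrite rk_top ltnn.
Qed.

Lemma chainP S F G : is_chain S -> F \in S -> G \in S ->
  (F <= G)%O || (G <= F)%O.
Proof. by move=> /forall_inP/(_ F)/[swap] FS /(_ FS)/forall_inP; apply. Qed.

Lemma chainS S S' : S \subset S' -> is_chain S' -> is_chain S.
Proof.
move=> sSS' cS'; apply/forall_inP => F FS; apply/forall_inP => G GS.
by apply: chainP cS' _ _; apply: (subsetP sSS').
Qed.

Lemma chainU1 S F : is_chain S -> {in S, forall G, (F <= G)%O || (G <= F)%O} ->
  is_chain (F |: S).
Proof.
move=> cS cF; apply/forall_inP => G; rewrite in_setU1 => GS.
apply/forall_inP => H; rewrite in_setU1 => HS.
case/predU1P: GS => [->|GS]; case/predU1P: HS => [->|HS].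
- by rewrite lexx.
- exact: cF.
- by rewrite orbC cF.
exact: chainP cS _ _.
Qed.

Lemma chain_le_rk S F G : is_chain S -> F \in S -> G \in S -> rk F <= rk G ->
  (F <= G)%O.
Proof.
move=> cS FS GS FG; have /orP[//|GF] := chainP cS FS GS.
by rewrite (flat_le_rk_eq GF).
Qed.

Lemma chain_rk_inj S : is_chain S -> {in S &, injective (fun F => rk F)}.
Proof.
move=> cS F G FS GS e; apply: le_anti.
by rewrite !(chain_le_rk cS) // e.
Qed.

Lemma chain_max S (P : pred (flat M)) F0 : is_chain S -> F0 \in S -> P F0 ->
  exists F, [/\ F \in S, P F & forall G, G \in S -> P G -> (G <= F)%O].
Proof.
move=> cS F0S PF0.
have F0P : (F0 \in S) && P F0 by rewrite F0S.
case: (@arg_maxnP _ F0 (fun F => (F \in S) && P F) (fun F => rk F) F0P) =>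
  F /andP[FS PF] Fmax.
exists F; split=> // G GS PG; apply: (chain_le_rk cS) => //.
by apply: Fmax; rewrite GS.
Qed.

Lemma chain_min S (P : pred (flat M)) F0 : is_chain S -> F0 \in S -> P F0 ->
  exists F, [/\ F \in S, P F & forall G, G \in S -> P G -> (F <= G)%O].
Proof.
move=> cS F0S PF0.
have F0P : (F0 \in S) && P F0 by rewrite F0S.
case: (@arg_minnP _ F0 (fun F => (F \in S) && P F) (fun F => rk F) F0P) =>
  F /andP[FS PF] Fmin.
exists F; split=> // G GS PG; apply: (chain_le_rk cS) => //.
by apply: Fmin; rewrite GS.
Qed.

Definition flag S := [&& is_chain S, \bot%O \in S & \top%O \in S].

Lemma flag_chain S : flag S -> is_chain S.
Proof. by case/and3P. Qed.

Lemma flag_convex S S' S'' : flag S -> S \subset S' -> S' \subset S'' ->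
  flag S'' -> flag S'.
Proof.
move=> /and3P[_ bS tS] /subsetP sS sS' /and3P[cS _ _].
by rewrite /flag (chainS sS') // !sS.
Qed.

Lemma flagU1 S F : flag S -> {in S, forall G, (F <= G)%O || (G <= F)%O} ->
  flag (F |: S).
Proof.
by move=> /and3P[cS bS tS] cF; rewrite /flag chainU1 // !inE bS tS !orbT.
Qed.

Definition gap S F G := [/\ F \in S, G \in S, (F < G)%O &
  {in S, forall H, (H <= F)%O || (G <= H)%O}].

Lemma link_cmp S F G : F \in link flag S -> G \in S -> (F < G)%O || (G < F)%O.
Proof.
rewrite inE => /andP[FS /flag_chain cF] GS.
have /orP[] := chainP cF (setU11 F S) (setU1r F GS).
  by rewrite le_eqVlt => /predU1P[FG|->] //; rewrite FG GS in FS.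
by rewrite le_eqVlt => /predU1P[FG|->]; rewrite ?orbT //; rewrite -FG GS in FS.
Qed.

Lemma link_lt_rk S F G : F \in link flag S -> G \in S -> rk F <= rk G ->
  (F < G)%O.
Proof.
move=> FS GS FG; have /orP[//|/flat_lt_rk] := link_cmp FS GS.
by rewrite ltnNge FG.
Qed.

Lemma link_gt_rk S F G : F \in link flag S -> G \in S -> rk G <= rk F ->
  (G < F)%O.
Proof.
move=> FS GS GF; have /orP[/flat_lt_rk|//] := link_cmp FS GS.
by rewrite ltnNge GF.
Qed.

Lemma gap_link S F G H : flag S -> gap S F G -> (F < H)%O -> (H < G)%O ->
  H \in link flag S.
Proof.
move=> fS [FS GS FG gapS] FH HG; rewrite inE flagU1 => [|//|K KS].
  rewrite andbT; apply/negP => /gapS /orP[HF|GH].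
    by have := lt_le_trans FH HF; rewrite ltxx.
  by have := lt_le_trans HG GH; rewrite ltxx.
have /orP[KF|GK] := gapS K KS.
  by rewrite (le_trans KF (ltW FH)) orbT.
by rewrite (le_trans (ltW HG) GK).
Qed.

Lemma link_gap S H : flag S -> H \in link flag S ->
  exists F G, [/\ gap S F G, (F < H)%O & (H < G)%O].
Proof.
move=> fS HS; have /and3P[cS bS tS] := fS.
have [|F [FS FH Fmax]] := @chain_max S (fun F => (F < H)%O) \bot%O cS bS.
  by apply: link_gt_rk HS bS _; rewrite rk_bot.
have [|G [GS HG Gmin]] := @chain_min S (fun F => (H < F)%O) \top%O cS tS.
  by apply: link_lt_rk HS tS _; rewrite rk_le.
exists F, G; split=> //; split=> //; first exact: lt_trans HG.
move=> K KS; have /orP[HK|KH] := link_cmp HS KS.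
  by rewrite Gmin ?orbT.
by rewrite Fmax.
Qed.

(** The missing ranks record the type of a flag; their number is its codimension, by
    [card_missing]. *)
Definition missing S t := (t <= mrank M) && [forall F in S, rk F != t].

Lemma missingP S t F : missing S t -> F \in S -> rk F <> t.
Proof. by case/andP=> _ /forall_inP h FS; apply/eqP/h. Qed.

Lemma nmissingP S t : t <= mrank M -> ~~ missing S t ->
  exists2 F, F \in S & rk F = t.
Proof.
move=> tr; rewrite /missing tr negb_forall_in => /exists_inP[F FS].
by rewrite negbK => /eqP; exists F.
Qed.

Lemma card_missing S : is_chain S ->
  #|[set t : 'I_(mrank M).+1 | missing S t]| + #|S| = (mrank M).+1.
Proof.
move=> cS; pose f F : 'I_(mrank M).+1 := inord (rk F).
have fE F : f F = rk F :> nat by rewrite inordK // ltnS rk_le.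
have <- : #|f @: S| = #|S|.
  apply: card_in_imset => F G FS GS /(congr1 val) /=; rewrite !fE.
  exact: chain_rk_inj cS _ _ FS GS.
rewrite -[RHS]card_ord -(cardsC (f @: S)) addnC; congr (_ + _).
apply: eq_card => t; rewrite !inE /missing -ltnS ltn_ord /=.
apply/forall_inP/idP => [h|tS F FS].
  by apply/negP => /imsetP[F FS e]; have := h F FS; rewrite e fE eqxx.
apply: contra tS => /eqP e; apply/imsetP; exists F => //.
by apply: val_inj; rewrite /= fE.
Qed.

Lemma gap_missing S F G t : gap S F G -> rk F < t < rk G -> missing S t.
Proof.
move=> [_ _ _ gapS] /andP[Ft tG]; apply/andP; split.
  by rewrite (leq_trans (ltnW tG)) ?rk_le.
apply/forall_inP => H /gapS /orP[] /flat_le_rk HF; apply/eqP; lia.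
Qed.

Lemma missing_gap S t : flag S -> missing S t ->
  exists F G, [/\ gap S F G, rk F < t & t < rk G].
Proof.
move=> /and3P[cS bS tS] mS; have neq F : F \in S -> rk F <> t
  by apply: missingP.
have [|F [FS Ft Fmax]] := @chain_max S (fun F => rk F < t) \bot%O cS bS.
  by have := neq _ bS; rewrite rk_bot; lia.
have [|G [GS tG Gmin]] := @chain_min S (fun F => t < rk F) \top%O cS tS.
  by have := neq _ tS; case/andP: mS; rewrite rk_top; lia.
exists F, G; split=> //; split=> // [|H HS].
  have FG : (F <= G)%O by apply: (chain_le_rk cS) => //; lia.
  by rewrite lt_neqAle FG andbT; apply/eqP => e; move: Ft; rewrite e; lia.
have := neq H HS; case: (ltnP (rk H) t) => [Ht _|tH e]; first by rewrite Fmax.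
by rewrite Gmin ?orbT //; lia.
Qed.

Lemma link_missing S F : flag S -> F \in link flag S -> missing S (rk F).
Proof.
move=> fS FS; rewrite /missing rk_le; apply/forall_inP => G GS; apply/eqP => e.
by have := link_lt_rk FS GS; rewrite e leqnn => /(_ isT)/flat_lt_rk;
  rewrite e ltnn.
Qed.

Lemma gap_cover S F G : flag S -> gap S F G ->
  rk G > (rk F).+1 -> exists2 H, H \in link flag S & rk H = (rk F).+1.
Proof.
move=> fS gS FG; have [FS GS ltFG _] := gS.
have [x xG xF] := flat_ltP ltFG.
exists (clU F x); last exact: rk_clU.
apply: gap_link fS gS (lt_clU xF) _; rewrite lt_neqAle clU_le xG (ltW ltFG)
  !andbT.
by apply/eqP => e; move: FG; rewrite -e rk_clU // ltnn.
Qed.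

Lemma flag_pure S : flag S -> #|S| < (mrank M).+1 -> link flag S != set0.
Proof.
move=> fS cS; have := card_missing (flag_chain fS) => cm.
have /card_gt0P[t] : 0 < #|[set t : 'I_(mrank M).+1 | missing S t]| by lia.
rewrite inE => /(missing_gap fS)[F [G [gS Ft tG]]].
have [|H HS _] := gap_cover fS gS; first lia.
by apply/set0Pn; exists H.
Qed.

End Rank.

(** * Affine functions on flats and the balancing condition *)

Section Affine.
Variables (T : finType) (M : matroid T).
Implicit Types (F G H A B : flat M) (S : {set flat M}) (x : T).
Implicit Types (v l : {ffun flat M -> rat}).

Local Notation rk F := (mrank_of M (flat_set F)).
Local Notation link S := (link (@flag T M) S).

(** Linear forms evaluated at the indicator vectors of flats, up to a constant. Vanishing at bottom
    and top forces the weights of the non-loops to sum to 0: these are the linear functions on the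
    ambient space of the Bergman fan, taken modulo the all-ones vector. *)
Definition affine l := exists c (y : T -> rat),
  forall F, l F = c + \sum_(i in flat_set F) y i.

Lemma affine0 : affine 0.
Proof. by exists 0, (fun=> 0) => F; rewrite ffunE big1 ?addr0. Qed.

Lemma affineP a l1 l2 : affine l1 -> affine l2 ->
  affine ([ffun F => a * l1 F] + l2).
Proof.
move=> [c1 [y1 E1]] [c2 [y2 E2]].
exists (a * c1 + c2), (fun i => a * y1 i + y2 i) => F.
by rewrite !ffunE E1 E2 big_split -mulr_sumr /=; ring.
Qed.

Lemma affine_cst c : affine [ffun=> c].
Proof. by exists c, (fun=> 0) => F; rewrite ffunE big1 ?addr0. Qed.

Lemma affine_mem x : affine [ffun F : flat M => (x \in F)%:R].
Proof.
exists 0, (fun i => (i == x)%:R) => F; rewrite ffunE add0r.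
have [xF|xF] := boolP (x \in F).
  rewrite (bigD1 x) //= eqxx big1 ?addr0 // => i /andP[_ /negPf->] //.
by rewrite big1 // => i iF; case: eqP => // ix; rewrite -ix iF in xF.
Qed.

(** Induction on the chain: the value at the largest member [B] is corrected by the indicator of a
    point of [B] outside the next member [A], which vanishes on the rest of the chain. *)
Lemma affine_interp S v : is_chain S -> exists2 l, affine l & {in S, l =1 v}.
Proof.
have [m] := ubnP #|S|; elim: m S => // m IH S cm cS.
have [->|[F0 F0S]] := set_0Vmem S.
  by exists 0; [exact: affine0 | move=> F; rewrite inE].
have [B [BS _ Bmax]] := @chain_max _ _ S predT F0 cS F0S isT.
have [||l al lv] := IH (S :\ B); last first.
- have [S'0|[A0 A0S]] := set_0Vmem (S :\ B).
    exists [ffun=> v B]; first exact: affine_cst.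
    move=> F FS; rewrite ffunE; case: (eqVneq F B) => [->//|FB].
    by have := in_set0 F; rewrite -S'0 in_setD1 FB FS.
  have [|A [AS _ Amax]] := @chain_max _ _ (S :\ B) predT A0 _ A0S isT.
    by apply: chainS cS; exact: subD1set.
  have [nAB AinS] := setD1P AS.
  have [|x xB xA] := @flat_ltP _ _ A B; first by rewrite lt_neqAle nAB Bmax.
  pose e : {ffun flat M -> rat} :=
    [ffun F => (v B - l B) * [ffun F : flat M => (x \in F)%:R] F].
  exists (e + l); first by apply: affineP => //; exact: affine_mem.
  move=> F FS; rewrite !ffunE; case: (eqVneq F B) => [->|FB].
    by rewrite xB mulr1 subrK.
  have FS' : F \in S :\ B by rewrite in_setD1 FB.
  rewrite (lv F FS') (_ : x \in F = false) ?mulr0 ?add0r //.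
  by apply: contraNF xA; apply/subsetP; exact: (Amax F FS' isT).
- by apply: chainS cS; exact: subD1set.
- by move: cm; rewrite (cardsD1 B S) BS add1n ltnS.
Qed.

Lemma affine_dual : exists u : {set flat M} -> flat M -> {ffun flat M -> rat},
  forall S, flag S -> forall F,
    affine (u S F) /\ forall G, G \in S -> u S F G = (F == G)%:R.
Proof.
have h (S : {set flat M}) :
    exists uS : flat M -> {ffun flat M -> rat}, flag S -> forall F,
    affine (uS F) /\ forall G, G \in S -> uS F G = (F == G)%:R.
  have [fS|] := boolP (flag S); last by exists (fun=> 0).
  have hF F : exists l, affine l /\ forall G, G \in S -> l G = (F == G)%:R.
    have [l al lv] := affine_interp [ffun G => (F == G)%:R] (flag_chain fS).
    by exists l; split=> // G GS; rewrite lv // ffunE.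
  by have [f fP] := fin_all_exists hF; exists f.
have [u uP] := fin_all_exists h.
by exists u => S fS F; exact: uP.
Qed.


(** The covers of [A] below [B] partition [B] minus [A], and both sides sum [y] over this set.
    Balancing of the Bergman fan rests on this partition. *)
Lemma cover_sum l A B : affine l -> (A <= B)%O ->
  \sum_(F | [&& (A < F)%O, (F <= B)%O & rk F == (rk A).+1]) (l F - l A) =
  l B - l A.
Proof.
move=> [c [y lE]] AB.
have sub F : (A <= F)%O -> l F - l A = \sum_(i in flat_set F | i \notin A) y i.
  move=> AF; rewrite !lE opprD addrACA subrr add0r.
  rewrite (bigID (mem (flat_set A))) /= addrC addrA.
  rewrite [X in _ + X + _](eq_bigl (mem (flat_set A))) ?addNr ?add0r // => i /=.
  by rewrite andb_idl //; apply: (subsetP AF).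
rewrite sub //; under eq_bigr => F /and3P[AF _ _] do rewrite (sub F (ltW AF)).
rewrite (exchange_big_dep (fun i => (i \in B) && (i \notin A))) /=; last first.
  move=> F i /and3P[_ FB _] /andP[iF ->]; rewrite andbT.
  exact: (subsetP FB).
apply: eq_bigr => i /andP[iB iA]; rewrite (big_pred1 (clU A i)) // => F.
rewrite /= iA andbT; apply/andP/eqP => [[/and3P[AF FB /eqP rF] iF]|->].
  by apply: clU_unique => //; exact: ltW.
by rewrite in_clU lt_clU // clU_le iB AB rk_clU // eqxx.
Qed.

Lemma gap2_sum l A B : affine l -> (A < B)%O -> rk B = (rk A).+2 ->
  \sum_(F | (A < F)%O && (F < B)%O) (l F - l A) = l B - l A.
Proof.
move=> al AB rB; rewrite -(cover_sum al (ltW AB)); apply: eq_bigl => F.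
apply/andP/and3P => [[AF FB]|[AF FB /eqP rF]].
  split=> //; first exact: ltW.
  by have := flat_lt_rk AF; have := flat_lt_rk FB; rewrite rB; lia.
split=> //; rewrite lt_neqAle FB andbT; apply/eqP => e.
by move: rB; rewrite -e rF; lia.
Qed.

Lemma codim1_link S A B : flag S -> #|S| = mrank M -> gap S A B ->
  rk B = (rk A).+2 -> link S =i [pred F | (A < F)%O && (F < B)%O].
Proof.
move=> fS cS gS rB F; apply/idP/andP => [FS|[AF FB]];
  last exact: gap_link gS AF FB.
have [AS BS _ _] := gS; have := card_missing (flag_chain fS).
rewrite cS -add1n => /addIn/eqP/cards1P[t tE].
have miss s : missing S s -> s = t.
  move=> ms; have sr : (s < (mrank M).+1)%N by case/andP: (ms); rewrite ltnS.
  have : Ordinal sr \in [set t] by rewrite -tE inE.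
  by rewrite in_set1 => /eqP<-.
have rF : rk F = (rk A).+1.
  rewrite (miss _ (link_missing fS FS)) -(miss (rk A).+1) //.
  by apply: gap_missing gS _; rewrite rB !ltnS leqnn.
by rewrite (link_gt_rk FS AS) ?(link_lt_rk FS BS) // rF ?rB // ltnW.
Qed.

Lemma codim1_gap S : flag S -> #|S| = mrank M -> exists A B,
  gap S A B /\ rk B = (rk A).+2.
Proof.
move=> fS cS; have := card_missing (flag_chain fS).
rewrite cS -add1n => /addIn/eqP/cards1P[t tE].
have miss s : missing S s -> s = t.
  move=> ms; have sr : (s < (mrank M).+1)%N by case/andP: (ms); rewrite ltnS.
  have : Ordinal sr \in [set t] by rewrite -tE inE.
  by rewrite in_set1 => /eqP<-.
have mt : missing S t by have := set11 t; rewrite -tE inE.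
have [A [B [gS At tB]]] := missing_gap fS mt; exists A, B; split=> //.
have h s : (rk A < s < rk B)%N -> s = t by move/(gap_missing gS)/miss.
have := h (rk A).+1; have := h (rk B).-1; lia.
Qed.

Lemma flag_balance1 S l : flag S -> #|S|.+1 = (mrank M).+1 -> affine l ->
  {in S, forall F, l F = 0} -> \sum_(F in link S) l F = 0.
Proof.
move=> fS [cS] al l0; have [A [B [gS rB]]] := codim1_gap fS cS.
have [AS BS AB _] := gS.
transitivity (l B - l A); last by rewrite !l0 // subrr.
rewrite -(gap2_sum al AB rB) (l0 A AS); apply: eq_big => [F|F _].
  by rewrite (codim1_link fS cS gS rB).
by rewrite subr0.
Qed.

End Affine.

(** * The Lorentzian inequality in codimension 2 *)

(** Subtracting [a] times the second vector from [c] times the first kills the leading coordinate,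
    so the form is minus a sum of squares there. *)
Lemma reverse_cauchy_schwarz (R : realFieldType) (I : finType) (P : pred I)
    (a c : R) (b d : I -> R) (B := fun (s t : R) (f g : I -> R) =>
      s * t - \sum_(i | P i) f i * g i) :
  0 < B c c d d -> B a a b b * B c c d d <= B a c b d ^+ 2.
Proof.
move=> pos; have c2 : 0 < c ^+ 2.
  have : 0 <= \sum_(i | P i) d i * d i by apply: sumr_ge0 => i _;
    rewrite -expr2 sqr_ge0.
  by move: pos; rewrite /B -expr2; lra.
have e : c ^+ 2 * B a a b b - 2 * a * c * B a c b d + a ^+ 2 * B c c d d =
    - \sum_(i | P i) (c * b i - a * d i) ^+ 2.
  have -> : \sum_(i | P i) (c * b i - a * d i) ^+ 2 =
      c ^+ 2 * (\sum_(i | P i) b i * b i) -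
      2 * a * c * (\sum_(i | P i) b i * d i) +
      a ^+ 2 * (\sum_(i | P i) d i * d i).
    rewrite !mulr_sumr -sumrB -big_split; apply: eq_bigr => i _ /=.
    by ring.
  by rewrite /B; ring.
have le0 : c ^+ 2 * B a a b b - 2 * a * c * B a c b d + a ^+ 2 * B c c d d <= 0.
  by rewrite e oppr_le0 sumr_ge0 // => i _; rewrite sqr_ge0.
set x := B a a b b in le0 *; set y := B a c b d in le0 *.
set z := B c c d d in pos le0 *.
rewrite -(ler_pM2l c2) -subr_ge0.
have := mulr_ge0 (ltW pos)
  (_ : 0 <= - (c ^+ 2 * x - 2 * a * c * y + a ^+ 2 * z)).
rewrite oppr_ge0 => /(_ le0) h.
have := addr_ge0 h (sqr_ge0 (a * z - c * y)).
by congr (0 <= _); ring.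
Qed.

Section Base.
Variables (T : finType) (M : matroid T).
Implicit Types (F G H A B : flat M) (S : {set flat M}).
Implicit Types (x v l : {ffun flat M -> rat}).

Local Notation rk F := (mrank_of M (flat_set F)).
Local Notation link S := (link (@flag T M) S).

Variable u : {set flat M} -> flat M -> {ffun flat M -> rat}.
Hypothesis uP : forall S, flag S -> forall F,
  affine (u S F) /\ forall G, G \in S -> u S F G = (F == G)%:R.
Local Notation deg := (deg (@flag T M) u).

Lemma u_affine S F : flag S -> F \in S -> affine (u S F).
Proof. by move=> /uP/(_ F)[]. Qed.

Lemma u_dual S F G : flag S -> F \in S -> G \in S -> u S F G = (F == G)%:R.
Proof. by move=> /uP/(_ F)[_ h] _ /h. Qed.

Lemma interp_affine S v : flag S -> affine (interp u S v).
Proof. exact: (interp_lin (@affine0 T M) (@affineP T M) u_affine). Qed.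

Lemma interp_flag S v F : flag S -> F \in S -> interp u S v F = v F.
Proof. exact: (interpE u_dual). Qed.

Lemma deg_codim1 S A B v : flag S -> #|S| = mrank M -> gap S A B ->
    rk B = (rk A).+2 ->
  deg [:: v] S =
  \sum_(F | (A < F)%O && (F < B)%O) (v F - v A) - (v B - v A).
Proof.
move=> fS cS gS rB; have [AS BS AB _] := gS.
rewrite -(interp_flag v fS AS) -(interp_flag v fS BS).
rewrite -(gap2_sum (interp_affine v fS) AB rB) -sumrB.
apply: eq_big => [F|F _]; first by rewrite (codim1_link fS cS gS rB).
by rewrite mulr1; ring.
Qed.

Lemma codim2_missing S : flag S -> (#|S| + 2 = (mrank M).+1)%N ->
  exists s t, [/\ (s < t)%N, missing S s, missing S t &
    forall m, missing S m -> m = s \/ m = t].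
Proof.
move=> fS cS; have cm := card_missing (flag_chain fS).
have /eqP/cards2P[s [t [st E]]] :
  #|[set t : 'I_(mrank M).+1 | missing S t]| = 2%N by move: cm cS; lia.
have ms : missing S s by have := set21 s t; rewrite -E inE.
have mt : missing S t by have := set22 s t; rewrite -E inE.
have mm m : missing S m -> m = s \/ m = t :> nat.
  move=> mm; have mr : (m < (mrank M).+1)%N by case/andP: (mm); rewrite ltnS.
  have : Ordinal mr \in [set s; t] by rewrite -E inE.
  by rewrite in_set2 => /orP[] /eqP<-; [left|right].
have : s <> t :> nat by move=> /val_inj e; rewrite e eqxx in st.
case: (ltngtP s t) => // lt _; first by exists s, t.
by exists t, s; split=> // m /mm[]; [right|left].
Qed.

Lemma codim2_link S s t A B A' B' (f : flat M -> rat) : flag S -> (s < t)%N ->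
    (forall m, missing S m -> m = s \/ m = t) ->
    gap S A B -> (rk A < s < rk B)%N -> gap S A' B' -> (rk A' < t < rk B')%N ->
  \sum_(F in link S) f F =
  \sum_(F | [&& (A < F)%O, (F < B)%O & rk F == s]) f F +
  \sum_(F | [&& (A' < F)%O, (F < B')%O & rk F == t]) f F.
Proof.
move=> fS st miss gS /andP[As sB] gS' /andP[At tB].
have [AS BS _ _] := gS; have [AS' BS' _ _] := gS'.
rewrite (bigID (fun F => rk F == s)) /=; congr (_ + _); apply: eq_bigl => F.
  apply/andP/and3P => [[FS /eqP rF]|[AF FB ->]].
    by rewrite rF eqxx (link_gt_rk FS AS) ?(link_lt_rk FS BS) // rF ltnW.
  by rewrite (gap_link fS gS).
apply/andP/and3P => [[FS /eqP rF]|[AF FB /eqP rF]]; last first.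
  by rewrite (gap_link fS gS') // rF gtn_eqF.
have rF' : rk F = t by case: (miss _ (link_missing fS FS)).
by rewrite rF' eqxx (link_gt_rk FS AS') ?(link_lt_rk FS BS') // rF' ltnW.
Qed.

Lemma deg_codim2 S x v : {in S, forall F, x F = 0} ->
  deg [:: x; v] S = \sum_(F in link S) x F * deg [:: v] (F |: S).
Proof.
move=> x0; rewrite [LHS]/=; apply: eq_bigr => F FS.
rewrite [interp _ _ _ _](_ : _ = 0) ?subr0 // sum_ffunE big1 // => G GS.
by rewrite ffunE x0 // mul0r.
Qed.

(** Lets both functions be assumed to vanish on [S] in the explicit computations. *)
Lemma deg_reduce2 S x v : flag S -> (#|S| + 2 = (mrank M).+1)%N ->
  deg [:: x; v] S = deg [:: x - interp u S x; v - interp u S v] S.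
Proof.
move=> fS cS; have mod y w :
    deg [:: y - interp u S y; w] S = deg [:: y; w] S.
  apply: (deg_mod_lin (@affine0 T M) (@affineP T M) (@flag_convex T M)
    u_affine u_dual (@flag_balance1 T M) fS _ (interp_affine y fS)) => //.
  by move=> F _; rewrite !ffunE.
have swap y w : deg [:: y; w] S = deg [:: w; y] S.
  by apply: (deg_swap (@affine0 T M) (@affineP T M) (@flag_convex T M)
    u_affine u_dual (@flag_balance1 T M)).
by rewrite mod swap [RHS]swap mod.
Qed.

(* Both missing ranks lie in one interval [A, B] of rank 3: the form is
   [(sum of x over the points)^2] minus a sum of squares indexed by the lines,
   because two distinct points lie on a unique line. *)
Lemma lorentz_rank3 S A B x v : flag S -> (#|S| + 2 = (mrank M).+1)%N ->
    gap S A B -> rk B = (rk A).+3 ->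
    {in S, forall F, x F = 0} -> {in S, forall F, v F = 0} ->
    let P F := [&& (A < F)%O, (F < B)%O & rk F == (rk A).+1] in
    let Q F := [&& (A < F)%O, (F < B)%O & rk F == (rk A).+2] in
    (forall m, missing S m -> m = (rk A).+1 \/ m = (rk A).+2) ->
  deg [:: x; v] S = (\sum_(F | P F) x F) * (\sum_(F | P F) v F) -
    \sum_(G | Q G) (x G - \sum_(F | P F && (F < G)%O) x F) *
                   (v G - \sum_(F | P F && (F < G)%O) v F).
Proof.
move=> fS cS gS rB x0 v0 P Q miss; have [AS BS AB gapS] := gS.
have cSF F : F \in link S -> #|F |: S| = mrank M.
  by move=> /card_link->; apply: succn_inj; rewrite -cS addn2.
have PL F : P F -> F \in link S by case/and3P=> AF FB _;
  apply: gap_link gS AF FB.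
have QL F : Q F -> F \in link S by case/and3P=> AF FB _;
  apply: gap_link gS AF FB.
(* Once the point [F] is inserted, the remaining gap is from [F] to [B], and [v] vanishes at [B]. *)
have degP F : P F ->
    deg [:: v] (F |: S) = \sum_(G | Q G && (F < G)%O) (v G - v F) + v F.
  move=> PF; have FL := PL F PF; case/and3P: PF => AF FB /eqP rF.
  have gF : gap (F |: S) F B.
    split=> //; rewrite ?setU11 ?setU1r // => H.
    rewrite in_setU1 => /predU1P[->|HS]; first by rewrite lexx.
    have /orP[HA|->] := gapS H HS; last by rewrite orbT.
    by rewrite (le_trans HA (ltW AF)).
  rewrite (deg_codim1 v (link_flag FL) (cSF F FL) gF) ?rB ?rF //.
  rewrite (v0 B BS) sub0r opprK; congr (_ + _); apply: eq_bigl => G.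
  apply/andP/andP => [[FG GB]|[/and3P[AG GB _] FG] //]; split=> //.
  rewrite /Q GB (lt_trans AF FG) /=.
  by have := flat_lt_rk FG; have := flat_lt_rk GB; rewrite rB rF; clear; lia.
have degQ G : Q G ->
    deg [:: v] (G |: S) = \sum_(F | P F && (F < G)%O) v F - v G.
  move=> QG; have GL := QL G QG; case/and3P: QG => AG GB /eqP rG.
  have gG : gap (G |: S) A G.
    split=> //; rewrite ?setU11 ?setU1r // => H.
    rewrite in_setU1 => /predU1P[->|HS]; first by rewrite lexx orbT.
    have /orP[->//|HB] := gapS H HS.
    by rewrite (le_trans (ltW GB) HB) orbT.
  rewrite (deg_codim1 v (link_flag GL) (cSF G GL) gG) ?rG //.
  rewrite (v0 A AS) subr0; congr (_ - _); apply: eq_big => [F|F _];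
    last by rewrite subr0.
  apply/andP/andP => [[AF FG]|[/and3P[AF FB _] FG] //]; split=> //.
  rewrite /P AF (lt_trans FG GB) /=.
  by have := flat_lt_rk FG; have := flat_lt_rk AF; rewrite rG; clear; lia.
have line F F' : P F -> P F' -> F != F' -> exists G, forall H,
    [&& Q H, (F < H)%O & (F' < H)%O] = (H == G).
  move=> /and3P[AF FB /eqP rF] /and3P[AF' FB' /eqP rF'] nFF.
  have /subsetPn[i iF' iF] : ~~ (F' \subset F).
    by apply: contra nFF => F'F;
      rewrite eq_sym (flat_le_rk_eq (F := F') (G := F)) // rF rF'.
  have iA : i \notin A by apply: contra iF; apply: (subsetP (ltW AF)).
  have F'E : F' = clU A i by apply: clU_unique; rewrite // ltW.
  exists (clU F i) => H; apply/and3P/eqP => [[/and3P[AH HB /eqP rH] FH F'H]|->].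
    apply: clU_unique; rewrite ?ltW ?rH ?rF //.
    by apply: (subsetP (ltW F'H)).
  have rG : rk (clU F i) = (rk A).+2 by rewrite rk_clU // rF.
  have FG := lt_clU iF; have F'G : (F' < clU F i)%O.
    rewrite lt_neqAle {2}F'E clU_le in_clU (le_trans (ltW AF) (ltW FG)) !andbT.
    by apply/eqP => e; move: rG; rewrite -e rF'; clear; lia.
  rewrite /Q rG eqxx FG F'G (lt_trans AF FG) lt_neqAle clU_le (ltW FB) !andbT.
  rewrite (subsetP (ltW FB')) // andbT; split=> //.
  by apply/eqP => e; move: rG; rewrite e rB; clear; lia.
(* Double counting on the lines through [F]: each other point is on exactly one of them, while [F]
   itself is on all of them. *)
have star F : P F ->
    \sum_(G | Q G && (F < G)%O) \sum_(F' | P F' && (F' < G)%O) v F' =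
    \sum_(F' | P F') v F' + \sum_(G | Q G && (F < G)%O) v F - v F.
  move=> PF; rewrite (exchange_big_dep P) /=; last by move=> ? ? _ /andP[].
  rewrite (bigD1 F) //= [X in _ = X + _ - _](bigD1 F) //=.
  rewrite (eq_bigl (fun G => Q G && (F < G)%O)); last first.
    by move=> G; rewrite PF -andbA andbb.
  rewrite [X in _ + X](eq_bigr v); first by ring.
  move=> F' /andP[PF' nFF]; have [|G GE] := line F F' PF PF';
    first by rewrite eq_sym.
  by rewrite (big_pred1 G) // => H; rewrite PF' /= -andbA GE.
rewrite deg_codim2 // (@codim2_link _ (rk A).+1 (rk A).+2 A B A B) ?rB ?ltnSn
  //; last first.
- by clear; lia.
- by clear; lia.
rewrite (eq_bigr (fun F => x F * \sum_(G | Q G && (F < G)%O) (v G - v F) +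
  x F * v F)); last first.
  by move=> F PF; rewrite degP // mulrDr.
rewrite [X in _ + X](eq_bigr (fun G => x G * \sum_(F | P F && (F < G)%O) v F -
  x G * v G)); last first.
  by move=> G QG; rewrite degQ // mulrBr.
pose sx G := \sum_(F | P F && (F < G)%O) x F.
pose sv G := \sum_(F | P F && (F < G)%O) v F.
have exch (g : flat M -> rat) : \sum_(G | Q G) sx G * g G =
    \sum_(F | P F) x F * \sum_(G | Q G && (F < G)%O) g G.
  under eq_bigr => G _ do rewrite /sx mulr_suml.
  rewrite (exchange_big_dep P) /=; last by move=> ? ? _ /andP[].
  apply: eq_bigr => F PF; rewrite mulr_sumr; apply: eq_bigl => G.
  by rewrite PF.
have -> : \sum_(G | Q G) (x G - sx G) * (v G - sv G) =
    \sum_(G | Q G) (x G * v G - x G * sv G) - \sum_(G | Q G) sx G * v G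
    + \sum_(G | Q G) sx G * sv G.
  by rewrite -sumrB -big_split /=; apply: eq_bigr => G _; ring.
rewrite !exch [X in _ = _ - (_ + X)](eq_bigr (fun F =>
  x F * \sum_(F' | P F') v F' +
  (x F * \sum_(G | Q G && (F < G)%O) v F - x F * v F))); last first.
  by move=> F PF; rewrite /sv star //; ring.
rewrite !big_split /= -mulr_suml !sumrN.
rewrite (eq_bigr (fun F => x F * \sum_(G | Q G && (F < G)%O) v G -
    x F * \sum_(G | Q G && (F < G)%O) v F)); last first.
  by move=> F _; rewrite sumrB mulrBr.
by rewrite sumrB; ring.
Qed.

(** With the missing ranks in different gaps, a flat inserted in one leaves the other unchanged. As
    [v] vanishes on [S], its remaining degree is the same for every insertion, and the form is a
    product of two linear forms. *)
Lemma lorentz_rank22 S A B A' B' x v : flag S ->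
    (#|S| + 2 = (mrank M).+1)%N ->
    gap S A B -> rk B = (rk A).+2 -> gap S A' B' -> rk B' = (rk A').+2 ->
    (rk B <= rk A')%N ->
    {in S, forall F, x F = 0} -> {in S, forall F, v F = 0} ->
    (forall m, missing S m -> m = (rk A).+1 \/ m = (rk A').+1) ->
    let a (w : {ffun flat M -> rat}) := \sum_(F | (A < F)%O && (F < B)%O) w F in
    let b (w : {ffun flat M -> rat}) :=
      \sum_(F | (A' < F)%O && (F < B')%O) w F in
  deg [:: x; v] S = a x * b v + b x * a v.
Proof.
move=> fS cS gS rB gS' rB' rBA x0 v0 miss a b.
have [AS BS AB gapS] := gS; have [AS' BS' AB' gapS'] := gS'.
have BA : (B <= A')%O by apply: chain_le_rk (flag_chain fS) _ _ _.
have cSF F : F \in link S -> #|F |: S| = mrank M.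
  by move=> /card_link->; apply: succn_inj; rewrite -cS addn2.
rewrite deg_codim2 // (@codim2_link _ (rk A).+1 (rk A').+1 A B A' B') ?rB ?rB'
  ?ltnSn //; last first.
  by move: rBA; rewrite rB; clear; lia.
have simp (C D F : flat M) : rk D = (rk C).+2 ->
   [&& (C < F)%O, (F < D)%O & rk F == (rk C).+1] = (C < F)%O && (F < D)%O.
  move=> rD; apply/and3P/andP => [[]//|[CF FD]]; split=> //.
  by have := flat_lt_rk CF; have := flat_lt_rk FD; rewrite rD; clear; lia.
rewrite (eq_bigl _ _ (fun F => simp A B F rB))
  (eq_bigl _ _ (fun F => simp A' B' F rB')).
rewrite /a /b !mulr_suml; congr (_ + _); apply: eq_bigr => F /andP[AF FB].
  have FL := gap_link fS gS AF FB.
  have gF : gap (F |: S) A' B'.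
    split=> //; rewrite ?setU1r // => H; rewrite in_setU1 => /predU1P[->|HS].
      by rewrite (le_trans (ltW FB) BA).
    exact: gapS'.
  rewrite (deg_codim1 v (link_flag FL) (cSF F FL) gF) //.
  rewrite !(v0 A') ?(v0 B') // !subr0; congr (_ * _).
  by apply: eq_bigr => G _; rewrite subr0.
have FL := gap_link fS gS' AF FB.
have gF : gap (F |: S) A B.
  split=> //; rewrite ?setU1r // => H; rewrite in_setU1 => /predU1P[->|HS].
    by rewrite (le_trans BA (ltW AF)) orbT.
  exact: gapS.
rewrite (deg_codim1 v (link_flag FL) (cSF F FL) gF) //.
rewrite !(v0 A) ?(v0 B) // !subr0; congr (_ * _).
by apply: eq_bigr => G _; rewrite subr0.
Qed.

Lemma flag_lorentz2 S x v : flag S -> (#|S| + 2 = (mrank M).+1)%N ->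
    0 < deg [:: v; v] S ->
  deg [:: x; x] S * deg [:: v; v] S <= deg [:: x; v] S ^+ 2.
Proof.
move=> fS cS; rewrite (deg_reduce2 x x fS cS) (deg_reduce2 v v fS cS)
  (deg_reduce2 x v fS cS).
have z y : {in S, forall F, (y - interp u S y) F = 0}.
  by move=> F FS; rewrite !ffunE interp_flag ?subrr.
have x0 := z x; have v0 := z v.
move: (x - _) (v - _) x0 v0 => {z} {}x {}v x0 v0.
have [s [t [st ms mt miss]]] := codim2_missing fS cS.
have [A [B [gS As sB]]] := missing_gap fS ms.
have [A' [B' [gS' At tB]]] := missing_gap fS mt.
have hA m : (rk A < m < rk B)%N -> m = s \/ m = t by move/(gap_missing gS)/miss.
have hA' m : (rk A' < m < rk B')%N -> m = s \/ m = t
  by move/(gap_missing gS')/miss.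
have [AS BS AB gapS] := gS; have [AS' BS' AB' gapS'] := gS'.
(* Consecutive missing ranks share a gap of length 3; otherwise some rank between them is present
   and each has its own gap of length 2. *)
have [ts|st1] := eqVneq t s.+1.
  have rA : rk A = s.-1.
    by have := hA (rk A).+1; have := hA s.-1; move: As sB ts; clear; lia.
  have rB : rk B = (rk A).+3.
    have := missingP mt BS; have := hA s.+2; have := hA t.+1.
    by move: rA As sB ts; clear; lia.
  have sE : s = (rk A).+1 by move: rA As; clear; lia.
  have tE : t = (rk A).+2 by rewrite ts sE.
  have miss' m : missing S m -> m = (rk A).+1 \/ m = (rk A).+2.
    by move=> /miss; rewrite ts sE.
  have L y w y0 w0 := @lorentz_rank3 S A B y w fS cS gS rB y0 w0 miss'.
  rewrite (L _ _ x0 x0) (L _ _ x0 v0) (L _ _ v0 v0).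
  exact: reverse_cauchy_schwarz.
have nA : rk A = s.-1.
  by have := hA (rk A).+1; move: As sB st st1; clear; lia.
have nB : rk B = s.+1.
  by have := hA (rk B).-1; have := hA s.+1; move: nA As sB st st1; clear; lia.
have nA' : rk A' = t.-1.
  have := hA' (rk A').+1; have := hA' s.+1; have := missingP ms AS'.
  by move: At tB st st1; clear; lia.
have nB' : rk B' = t.+1.
  by have := hA' (rk B').-1; move: nA' At tB st st1; clear; lia.
have rB : rk B = (rk A).+2 by rewrite nA nB; move: As; clear; lia.
have rB' : rk B' = (rk A').+2 by rewrite nA' nB'; move: At; clear; lia.
have rBA : (rk B <= rk A')%N by rewrite nA' nB; move: st st1; clear; lia.
have miss' m : missing S m -> m = (rk A).+1 \/ m = (rk A').+1.
  by move=> /miss; move: As At nA nA'; clear; lia.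
have L y w y0 w0 :=
  @lorentz_rank22 S A B A' B' y w fS cS gS rB gS' rB' rBA y0 w0 miss'.
rewrite (L _ _ x0 x0) (L _ _ x0 v0) (L _ _ v0 v0).
have key (p q r w : rat) :
    (p * q + q * p) * (r * w + w * r) <= (p * w + q * r) ^+ 2.
  rewrite -subr_ge0 [X in 0 <= X](_ : _ = (p * w - q * r) ^+ 2).
    exact: sqr_ge0.
  by ring.
by move=> _; exact: key.
Qed.

End Base.

(** * Connectivity and convexity *)

Section Convexity.
Variables (T : finType) (M : matroid T).
Implicit Types (F G H A B : flat M) (S : {set flat M}).
Implicit Types (x v l : {ffun flat M -> rat}).

Local Notation rk F := (mrank_of M (flat_set F)).
Local Notation link S := (link (@flag T M) S).

Lemma link_link S F G : F \in link S -> G \in link S ->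
  (F < G)%O || (G < F)%O -> G \in link (F |: S).
Proof.
move=> FS GS FG; rewrite inE in_setU1 negb_or (link_notin GS) andbT.
apply/andP; split.
  by apply: contraTneq FG => ->; rewrite ltxx.
apply: flagU1; first exact: link_flag FS.
move=> H; rewrite in_setU1 => /predU1P[->|HS].
  by case/orP: FG => /ltW->; rewrite ?orbT.
by case/orP: (link_cmp GS HS) => /ltW->; rewrite ?orbT.
Qed.

(** Incomparable flats [F] and [G] of the link lie in the same gap. If it has length at least 3,
    they are joined through points [p] below [F] and [q] below [G] and a line [m] above both; if it
    has length 2, any flat of the link in another gap is comparable to both. *)
Lemma flag_connected S : flag S -> (#|S| + 3 <= (mrank M).+1)%N ->
  forall f : flat M -> rat,
    (forall F G, F \in link S -> G \in link (F |: S) -> f F = f G) ->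
  {in link S &, forall F G, f F = f G}.
Proof.
move=> fS cS f fE.
have e F G : F \in link S -> G \in link S -> (F < G)%O || (G < F)%O ->
  f F = f G.
  by move=> FS GS FG; apply: fE => //; exact: link_link.
move=> F G FS GS.
have [A [B [gS AF FB]]] := link_gap fS FS; have [AS BS AB gapS] := gS.
have [FG|nFG] := boolP ((F < G)%O || (G < F)%O); first exact: e.
move: nFG; rewrite negb_or => /andP[nFG nGF].
have AG : (A < G)%O.
  case/orP: (link_cmp GS AS) => // GA.
  by rewrite (lt_trans GA AF) in nGF.
have GB : (G < B)%O.
  case/orP: (link_cmp GS BS) => // BG.
  by rewrite (lt_trans FB BG) in nFG.
have [rAB|rAB] := leqP (rk A).+3 (rk B).
  have [i iF iA] := flat_ltP AF; have [j jG jA] := flat_ltP AG.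
  have PL H : (A < H)%O -> (rk H < rk B)%N -> (H <= B)%O -> H \in link S.
    move=> AH rH HB; apply: gap_link fS gS AH _.
    by rewrite lt_neqAle HB andbT; apply: contraTneq rH => ->; rewrite ltnn.
  have le_e P Q : P \in link S -> Q \in link S -> (P <= Q)%O -> f P = f Q.
    move=> PS QS; rewrite le_eqVlt => /predU1P[->//|PQ].
    by apply: e => //; rewrite PQ.
  pose p := clU A i; pose q := clU A j.
  have pF : (p <= F)%O by rewrite clU_le iF ltW.
  have qG : (q <= G)%O by rewrite clU_le jG ltW.
  have rp : rk p = (rk A).+1 by exact: rk_clU.
  have rq : rk q = (rk A).+1 by exact: rk_clU.
  have pS : p \in link S.
    apply: PL; [exact: lt_clU | by rewrite rp; move: rAB; clear; lia |].
    exact: le_trans pF (ltW FB).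
  have qS : q \in link S.
    apply: PL; [exact: lt_clU | by rewrite rq; move: rAB; clear; lia |].
    exact: le_trans qG (ltW GB).
  rewrite -(le_e p F) // -(le_e q G) //.
  have [jp|jp] := boolP (j \in p).
    suff -> : p = q by [].
    by apply: clU_unique; rewrite ?rp //; exact: le_clU.
  pose m := clU p j; have rm : rk m = (rk A).+2 by rewrite rk_clU // rp.
  have pm : (p <= m)%O by exact: le_clU.
  have Ap : (A < p)%O by exact: lt_clU.
  have mS : m \in link S.
    apply: PL; [exact: lt_le_trans pm | by rewrite rm |].
    rewrite clU_le (subsetP (ltW GB)) //=.
    exact: le_trans pF (ltW FB).
  rewrite (le_e p m) // (le_e q m) //.
  by rewrite clU_le in_clU (le_trans (ltW Ap)).
(* This gap misses a single rank, and at least three are missing in all, so some missing rank [t]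
   belongs to another gap. *)
have rB : rk B = (rk A).+2.
  by have := flat_lt_rk AF; have := flat_lt_rk FB; move: rAB; clear; lia.
have cm := card_missing (flag_chain fS).
pose X := [set t : 'I_(mrank M).+1 | missing S t].
have /set0Pn[t] : X :\ inord (rk A).+1 != set0.
  rewrite -card_gt0; have := cardsD1 (inord (rk A).+1) X.
  by have := leq_b1 (inord (rk A).+1 \in X); rewrite -/X in cm; move: cm cS;
    clear; lia.
rewrite in_setD1 inE => /andP[tA mt].
have nt : (t : nat) <> (rk A).+1.
  move=> te; case/eqP: tA; apply: val_inj; rewrite /= inordK // ltnS.
  by have := rk_le B; rewrite rB; clear; lia.
have [A' [B' [gS' At tB]]] := missing_gap fS mt.
have [AS' BS' AB' gapS'] := gS'.
have [|H HS rH] := gap_cover fS gS'; first by move: At tB; clear; lia.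
have nA := missingP mt AS; have nB := missingP mt BS.
have [tlt|tgt] : (t < rk A)%N \/ (rk B < t)%N.
  by move: nA nB nt; rewrite rB; clear; lia.
  have HA : (H < A)%O.
    by apply: link_lt_rk HS AS _; rewrite rH; move: At tlt; clear; lia.
  by rewrite (e F H) // -?(e H G) // ?(lt_trans HA AF) ?(lt_trans HA AG) ?orbT.
have HB : (B < H)%O.
  apply: (link_gt_rk HS BS); rewrite rH.
  have /orP[BA|BB] := gapS' B BS.
    by rewrite leqW // flat_le_rk.
  by have := flat_le_rk BB; move: tB tgt; clear; lia.
by rewrite (e F H) // -?(e H G) // ?(lt_trans FB HB) ?(lt_trans GB HB) ?orbT.
Qed.

Lemma affineD l1 l2 : affine l1 -> affine l2 -> affine (l1 + l2).
Proof. exact: (linD (@affineP T M)). Qed.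

(** Minus [alpha_lin i], [alpha] becomes the indicator of the proper flats containing [i]; minus
    [beta_lin i], with [i] not a loop, [beta] becomes the indicator of the flats other than bottom
    which avoid [i]. These are the usual classes alpha and beta of the Chow ring, and [i] may be
    chosen anew at each flag. *)
Definition alpha : {ffun flat M -> rat} := [ffun F => - (F == \top%O)%:R].
Definition beta : {ffun flat M -> rat} := [ffun F => - (F == \bot%O)%:R].

Definition alpha_lin (i : T) : {ffun flat M -> rat} :=
  [ffun F : flat M => - (i \in F)%:R].
Definition beta_lin (i : T) : {ffun flat M -> rat} :=
  [ffun F : flat M => (i \in F)%:R - 1].

Lemma affine_alpha_lin i : affine (alpha_lin i).
Proof.
rewrite (_ : alpha_lin i =
    [ffun F => -1 * [ffun F : flat M => (i \in F)%:R] F] + 0).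
  by apply: affineP; [exact: affine_mem | exact: affine0].
by apply/ffunP => F; rewrite !ffunE addr0 mulN1r.
Qed.

Lemma affine_beta_lin i : affine (beta_lin i).
Proof.
rewrite (_ : beta_lin i = [ffun F : flat M => (i \in F)%:R] + [ffun=> -1]).
  by apply: affineD; [exact: affine_mem | exact: affine_cst].
by apply/ffunP => F; rewrite !ffunE.
Qed.

Lemma alpha_lin_interp S A i :
    (forall G, G \in S -> G != \top%O -> (G <= A)%O) ->
  i \notin A -> {in S, alpha_lin i =1 alpha}.
Proof.
move=> maxA iA G GS; rewrite !ffunE; case: eqVneq => [->|GT];
  first by rewrite inE.
suff /negPf-> : i \notin G by [].
by apply: contra iA; apply/subsetP/maxA.
Qed.

Lemma beta_lin_interp S B i :
    (forall G, G \in S -> G != \bot%O -> (B <= G)%O) ->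
  i \in B -> i \notin (\bot%O : flat M) -> {in S, beta_lin i =1 beta}.
Proof.
move=> minB iB ib G GS; rewrite !ffunE; case: eqVneq => [->|Gb].
  by rewrite (negPf ib) sub0r.
by rewrite (subsetP (minB G GS Gb)) // subrr.
Qed.

(** A supporting function is [alpha_lin i] for a point [i] outside the largest proper member of the
    flag; for [beta], dually, [i] is a non-loop in the smallest member above bottom. *)
Lemma alpha_convex : (0 < mrank M)%N ->
  weakly_convex (@flag T M) (@affine T M) alpha.
Proof.
move=> rM S fS; have /and3P[cS bS tS] := fS.
have bt := flat_bottom_lt_top rM.
have [|A [AS At maxA]] := @chain_max _ _ S (fun G => G != \top%O) \bot%O cS bS.
  by rewrite lt_eqF.
have [|i _ iA] := @flat_ltP _ _ A \top%O; first by rewrite lt_neqAle At lex1.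
exists (alpha_lin i); split; first exact: affine_alpha_lin.
  exact: alpha_lin_interp maxA iA.
move=> F FS; rewrite !ffunE (_ : F == \top%O = false) ?oppr0 ?oppr_le0 ?ler0n
  //.
by apply: contraNF (link_notin FS) => /eqP->.
Qed.

Lemma beta_convex : (0 < mrank M)%N ->
  weakly_convex (@flag T M) (@affine T M) beta.
Proof.
move=> rM S fS; have /and3P[cS bS tS] := fS.
have bt := flat_bottom_lt_top rM.
have [|B [BS Bb minB]] := @chain_min _ _ S (fun G => G != \bot%O) \top%O cS tS.
  by rewrite gt_eqF.
have [|i iB ib] := @flat_ltP _ _ \bot%O B; first by rewrite lt_def Bb le0x.
exists (beta_lin i); split; first exact: affine_beta_lin.
  exact: beta_lin_interp minB iB ib.
move=> F FS; rewrite !ffunE (_ : F == \bot%O = false) ?oppr0 ?subr_le0 ?lern1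
  ?leq_b1 //.
by apply: contraNF (link_notin FS) => /eqP->.
Qed.

(** This is minus the square of the cardinality, expanded over ordered pairs so that a supporting
    function can be found pair by pair. *)
Definition neg_card_sq : {ffun flat M -> rat} :=
  [ffun F : flat M => - \sum_(p : T * T) (p.1 \in F)%:R * (p.2 \in F)%:R].

(* [neg_card_sq] is a sum over pairs [(i, j)]; along a flag, the product of the
   two indicators is interpolated by the indicator of the element which enters
   last, or by their mean when both enter at the same step. *)
Lemma neg_card_sq_convex :
  strictly_convex (@flag T M) (@affine T M) neg_card_sq.
Proof.
move=> S fS; pose before i j :=
  [exists G in S, (i \in flat_set G) && (j \notin flat_set G)].
have asym i j : before i j -> before j i = false.
  case/exists_inP=> G GS /andP[iG jG].
  apply/negbTE/negP => /exists_inP[H HS /andP[jH iH]].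
  have /orP[GH|HG] := chainP (flag_chain fS) GS HS.
    by have := subsetP GH i iG; rewrite (negPf iH).
  by have := subsetP HG j jH; rewrite (negPf jG).
pose w i j : rat := if before j i then 1 else if before i j then 0 else 2^-1.
have wD i j : w i j + w j i = 1.
  rewrite /w; case: (boolP (before j i)) => [/asym->|_]; first by rewrite addr0.
  by case: (before i j); rewrite ?add0r // -mulr2n -mulr_natr mulVf.
have w_ge0 i j : 0 <= w i j.
  by rewrite /w; do 2!case: ifP => // _; rewrite ?ler01 // invr_ge0.
pose l : {ffun flat M -> rat} := \sum_(p : T * T)
  ([ffun F => - w p.1 p.2 * [ffun F : flat M => (p.1 \in F)%:R] F] +
   ([ffun F => - w p.2 p.1 * [ffun F : flat M => (p.2 \in F)%:R] F] + 0)).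
pose t F (p : T * T) : rat :=
  w p.1 p.2 * (p.1 \in F)%:R + w p.2 p.1 * (p.2 \in F)%:R
  - (p.1 \in F)%:R * (p.2 \in F)%:R.
have lE F : neg_card_sq F = l F + \sum_p t F p.
  rewrite /l sum_ffunE -big_split ffunE -sumrN; apply: eq_bigr => p _ /=.
  by rewrite /t !ffunE; ring.
have tE F i j : t F (i, j) =
    if i \in F then if j \in F then 0 else w i j
    else if j \in F then w j i else 0.
  rewrite /t /=; case: (i \in F); case: (j \in F) => /=;
    rewrite ?mulr1 ?mulr0 ?addr0 ?add0r ?subr0 //.
  by rewrite wD subrr.
have t_ge0 F p : 0 <= t F p.
  by case: p => i j; rewrite tE; do 2!case: ifP.
exists l; split.
- apply: big_ind => [|l1 l2|p _]; [exact: affine0 | exact: affineD |].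
  by apply/affineP/affineP; [exact: affine_mem | exact: affine_mem |
    exact: affine0].
- move=> F FS; rewrite lE big1 ?addr0 // => -[i j] _; rewrite tE.
  have bf a b : a \in F -> b \notin F -> before a b.
    by move=> aF bF; apply/exists_inP; exists F; rewrite ?aF.
  case: (boolP (i \in F)) => iF; case: (boolP (j \in F)) => jF //.
    by rewrite /w (asym _ _ (bf _ _ iF jF)) (bf _ _ iF jF).
  by rewrite /w (asym _ _ (bf _ _ jF iF)) (bf _ _ jF iF).
move=> F FS; have [A [B [[AS BS AB gapS] AF FB]]] := link_gap fS FS.
(* Strictness comes from a pair that [F] separates although both points enter the flag between [A]
   and [B]: it contributes 1/2. *)
have [i iF iA] := flat_ltP AF; have [j jB jF] := flat_ltP FB.
rewrite lE ltrDl (bigD1 (i, j)) //= ltr_pwDl ?sumr_ge0 // tE iF (negPf jF).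
have nb a b : a \notin A -> b \in B -> before a b = false.
  move=> aA bB; apply/negbTE/negP => /exists_inP[G /gapS/orP[GA|BG]].
    by case/andP=> /(subsetP GA); rewrite (negPf aA).
  by case/andP=> _; rewrite (subsetP BG b bB).
have iB : i \in B by apply: (subsetP (ltW FB)).
have jA : j \notin A by apply: contra jF; apply: (subsetP (ltW AF)).
by rewrite /w !nb ?invr_gt0.
Qed.

End Convexity.

(** * The reduced characteristic polynomial as a degree *)

Section CharPoly.
Variables (T : finType) (M : matroid T).
Implicit Types (F G H A B : flat M) (S : {set flat M}) (i : T).

Local Notation rk F := (mrank_of M (flat_set F)).
Local Notation mu F := (mobius (\bot%O : flat M) F).

Lemma clU_id F i : i \in F -> clU F i = F.
Proof. by move=> iF; apply: le_anti; rewrite clU_le iF lexx le_clU. Qed.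

(** Induction on the rank: the sum of [mu] over all flats below [F] is 0; grouping by [clU G i]
    leaves the group of [F], since the groups of smaller flats vanish. *)
Lemma weisner F i : i \notin (\bot%O : flat M) -> i \in F ->
  \sum_(G | clU G i == F) mu G = 0.
Proof.
move=> ib; have [m] := ubnP (rk F); elim: m F => // m IH F rF iF.
have bF : (\bot < F)%O.
  by rewrite lt_def le0x andbT; apply: contraTneq iF => ->.
have := mobius_sum0 bF; rewrite (partition_big (fun G => clU G i)
  (fun H : flat M => (H <= F)%O && (i \in H))) /=; last first.
  by move=> G /andP[_ GF]; rewrite clU_le iF GF in_clU.
rewrite (bigD1 F) /= ?lexx //.
rewrite [X in _ + X]big1 => [|H /andP[/andP[HF iH] HnF]].
  rewrite addr0 => e; rewrite -[RHS]e; apply: eq_bigl => G.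
  rewrite le0x /= andb_idl // => /eqP<-; exact: le_clU.
rewrite -[RHS](IH H) //; last first.
  by have := flat_lt_rk (_ : (H < F)%O); rewrite lt_neqAle HnF HF => /(_ isT);
    move: rF; clear; lia.
apply: eq_bigl => G; rewrite le0x /= andb_idl // => /eqP e.
by rewrite (le_trans _ HF) // -e le_clU.
Qed.

Lemma mobius_cover F i : i \notin (\bot%O : flat M) -> i \in F ->
  mu F = - \sum_(G : flat M | (i \notin G) && (clU G i == F)) mu G.
Proof.
move=> ib iF; apply/eqP; rewrite -subr_eq0 opprK -[X in _ == X](weisner ib iF).
rewrite [X in _ == X](bigID (fun G : flat M => i \in G)) /=; apply/eqP;
  congr (_ + _).
  rewrite (big_pred1 F) // => G; apply/andP/eqP => [[/eqP e iG]|->].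
    by rewrite -e clU_id.
  by rewrite clU_id ?eqxx.
by apply: eq_bigl => G; rewrite andbC.
Qed.

(** The unsigned Möbius function, by [nu_ge0]. *)
Definition nu F : int := (-1) ^+ rk F * mu F.

Lemma nu_bot : nu \bot%O = 1.
Proof. by rewrite /nu rk_bot mobiusxx. Qed.

(** Weisner's relation involves, besides [F], only flats covered by [F], so the alternating signs
    cancel and a recursion with positive terms remains. *)
Lemma nu_cover F i : i \notin (\bot%O : flat M) -> i \in F ->
  nu F =
    \sum_(G : flat M | [&& (G < F)%O, i \notin G & (rk G).+1 == rk F]) nu G.
Proof.
move=> ib iF; rewrite {1}/nu (mobius_cover ib iF) mulrN mulr_sumr -sumrN.
apply: eq_big => [G|G /andP[iG /eqP<-]]; last first.
  by rewrite rk_clU // exprS mulN1r mulNr opprK.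
apply/andP/and3P => [[iG /eqP<-]|[GF iG /eqP rF]].
  by rewrite lt_clU // rk_clU.
by rewrite iG (clU_unique (ltW GF) iF iG) ?rF.
Qed.

Lemma nu_ge0 F : 0 <= nu F.
Proof.
have [m] := ubnP (rk F); elim: m F => // m IH F rF.
have [->|Fb] := eqVneq F \bot%O; first by rewrite nu_bot.
have [|i iF ib] := @flat_ltP _ _ \bot%O F; first by rewrite lt_def Fb le0x.
rewrite (nu_cover ib iF) sumr_ge0 // => G /and3P[/flat_lt_rk GF _ _].
by apply: IH; move: GF rF; clear; lia.
Qed.

Lemma nu_rk1 F : rk F = 1%N -> nu F = 1.
Proof.
move=> rF; have bF : (\bot < F)%O by rewrite lt_bot_rk rF.
have [i iF ib] := flat_ltP bF.
rewrite (nu_cover ib iF) (big_pred1 \bot%O) ?nu_bot // => G /=.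
rewrite rF; apply/and3P/eqP => [[_ _ /eqP[rG]]|->]; last by rewrite rk_bot.
by apply/esym/flat_le_rk_eq; rewrite ?le0x // rG.
Qed.

Lemma saturated_chain F : exists C : {set flat M},
  [/\ is_chain C, C \subset Defs.interval F \top%O &
    #|C| = (mrank M - rk F).+1].
Proof.
have [m] := ubnP (mrank M - rk F)%N; elim: m F => // m IH F rF.
have [->|FT] := eqVneq F \top%O.
  exists [set \top%O]; rewrite cards1 rk_top subnn; split=> //.
    by apply/forall_inP => G /set1P->; apply/forall_inP => H /set1P->;
      rewrite lexx.
  by rewrite sub1set inE lexx.
have [|i _ iF] := @flat_ltP _ _ F \top%O; first by rewrite lt_neqAle FT lex1.
have rF' := rk_clU iF; have rT := rk_le (clU F i).
have [|C [cC sC cardC]] := IH (clU F i); first by move: rF rF' rT; clear; lia.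
have FC G : G \in C -> (F < G)%O.
  move=> /(subsetP sC); rewrite inE => /andP[cG _].
  exact: lt_le_trans (lt_clU iF) cG.
exists (F |: C); split.
- by apply: chainU1 => // G /FC/ltW->.
- apply/subsetP => G; rewrite in_setU1 inE lex1 andbT.
  by case/predU1P => [->|/FC/ltW].
have FnC : F \notin C by apply/negP => /FC; rewrite ltxx.
by rewrite cardsU1 FnC cardC; move: rF' rT; clear; lia.
Qed.

(** Ranks are distinct along a chain, which bounds its length; adding points one at a time attains
    the bound. *)
Lemma interval_rank_top F : interval_rank F \top%O = (mrank M - rk F)%N.
Proof.
apply/eqP; rewrite eqn_leq; apply/andP; split.
  apply/bigop.bigmax_leqP => C /andP[cC sC].
  pose f G : 'I_(mrank M - rk F).+1 := inord (rk G - rk F).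
  have fE G : G \in C -> f G = (rk G - rk F)%N :> nat.
    move=> /(subsetP sC); rewrite inE => /andP[FG _].
    by rewrite inordK // ltnS leq_sub2r // rk_le.
  have : (#|f @: C| <= (mrank M - rk F).+1)%N.
    by rewrite -[X in (_ <= X)%N]card_ord max_card.
  rewrite card_in_imset; first by case: (#|C|).
  move=> G H GC HC /(congr1 val) /=; rewrite !fE // => e.
  apply: (chain_rk_inj cC) => //.
  have := subsetP sC _ GC; have := subsetP sC _ HC; rewrite !inE.
  by case/andP=> /flat_le_rk FH _ /andP[/flat_le_rk FG _]; move: e FH FG; clear;
    lia.
have [C [cC sC cardC]] := saturated_chain F.
by apply: (bigop.bigmax_sup C); rewrite ?cC // cardC.
Qed.

(** Multiply by ['X - 1]: the terms with ['X] give the flats avoiding [i], and those with -1,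
    grouped by [F = clU G i], give the flats containing [i] by [mobius_cover]. *)
Lemma reduced_characteristic_polyE i : i \notin (\bot%O : flat M) ->
  reduced_characteristic_poly M =
  \sum_(G : flat M | i \notin G) mu G *: 'X^(mrank M - (rk G).+1).
Proof.
move=> ib; have bt : (\bot < \top :> flat M)%O.
  by rewrite lt_neqAle lex1 andbT; apply: contraNneq ib => ->; rewrite inE.
have rM : (0 < mrank M)%N by rewrite -rk_top -lt_bot_rk.
have X1 : 'X - 1 != 0 :> {poly int} by rewrite -polyC1 polyXsubC_eq0.
apply: (mulIf X1); rewrite reduced_characteristic_polyK // /characteristic_poly.
under eq_bigr => F _ do rewrite interval_rank_top.
rewrite (bigID (fun F : flat M => i \in F)) /= addrC mulrBr mulr1;
  congr (_ + _).
  rewrite mulr_suml; apply: eq_bigr => G iG.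
  rewrite -scalerAl -exprSr subnSK //.
  by have := flat_lt_rk (lt_clU iG); have := rk_le (clU G i); clear; lia.
rewrite [in RHS](partition_big (fun G => clU G i) (fun F : flat M =>
  i \in F)) /=; last first.
  by move=> G _; exact: in_clU.
rewrite -sumrN; apply: eq_bigr => F iF.
rewrite (mobius_cover ib iF) scaleNr scaler_suml; congr (- _).
by apply: eq_bigr => G /andP[iG /eqP<-]; rewrite rk_clU.
Qed.

(** All flats contributing to one coefficient have the same rank, hence the same sign of [mu], and
    absolute values add up. *)
Lemma coef_reduced_characteristic_poly i m : i \notin (\bot%O : flat M) ->
    (m < mrank M)%N ->
  `|(reduced_characteristic_poly M)`_m| =
  \sum_(G : flat M | (i \notin G) && (rk G + m.+1 == mrank M)%N) nu G.
Proof.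
move=> ib mr; rewrite (reduced_characteristic_polyE ib) coef_sum.
have -> : \sum_(G : flat M | i \notin G) (mu G *: 'X^(mrank M - (rk G).+1))`_m =
    (-1) ^+ (mrank M - m.+1) *
    \sum_(G : flat M | (i \notin G) && (rk G + m.+1 == mrank M)%N) nu G.
  rewrite mulr_sumr big_mkcondr /=; apply: eq_bigr => G iG.
  rewrite coefZ coefXn; have := flat_lt_rk (lt_clU iG); have := rk_le (clU G i).
  move=> h1 h2; have -> : (m == (mrank M - (rk G).+1)%N) =
      (rk G + m.+1 == mrank M)%N.
    by apply/eqP/eqP; move: h1 h2; clear; lia.
  case: eqP => [e|_]; last by rewrite mulr0.
  have -> : (mrank M - m.+1)%N = rk G by move: e; clear; lia.
  by rewrite mulr1 /nu mulrA -exprMn mulrNN mulr1 expr1n mul1r.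
rewrite normrM normrX normrN1 expr1n mul1r ger0_norm // sumr_ge0 // => G _.
exact: nu_ge0.
Qed.

End CharPoly.

(** * Degrees of products of powers of beta and alpha *)

Section Evaluation.
Variables (T : finType) (M : matroid T).
Implicit Types (F G H A B : flat M) (S : {set flat M}) (i : T).
Implicit Types (v l : {ffun flat M -> rat}).

Local Notation rk F := (mrank_of M (flat_set F)).
Local Notation link S := (link (@flag T M) S).

Variable u : {set flat M} -> flat M -> {ffun flat M -> rat}.
Hypothesis uP : forall S, flag S -> forall F,
  affine (u S F) /\ forall G, G \in S -> u S F G = (F == G)%:R.
Local Notation deg := (deg (@flag T M) u).

Lemma deg_flag_interp vs v S l : flag S ->
    (#|S| + (size vs).+1)%N = (mrank M).+1 ->
    affine l -> {in S, l =1 v} ->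
  deg (v :: vs) S = \sum_(F in link S) (v F - l F) * deg vs (F |: S).
Proof.
exact: (deg_interp (@affine0 T M) (@affineP T M) (@flag_convex T M)
  (u_affine uP) (u_dual uP) (@flag_balance1 T M)).
Qed.

Lemma deg_alpha vs S A i : flag S -> (#|S| + (size vs).+1)%N = (mrank M).+1 ->
    A \in S -> (A < \top)%O ->
    (forall G, G \in S -> G != \top%O -> (G <= A)%O) ->
    i \notin A ->
  deg (@alpha T M :: vs) S =
  \sum_(F : flat M | [&& (A < F)%O, (F < \top)%O & i \in F]) deg vs (F |: S).
Proof.
move=> fS cS AS At maxA iA; have /and3P[_ _ tS] := fS.
have gS : gap S A \top%O.
  split=> // G GS; have [->|GT] := eqVneq G \top%O; first by rewrite lexx orbT.
  by rewrite maxA.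
rewrite (deg_flag_interp fS cS (affine_alpha_lin M i) (alpha_lin_interp maxA
  iA)).
rewrite (bigID (fun F : flat M => i \in F)) /= [X in _ + X]big1 ?addr0;
  last first.
  move=> F /andP[FS /negPf iF]; rewrite !ffunE iF (_ : F == \top%O = false).
    by rewrite subrr mul0r.
  by apply: contraNF (link_notin FS) => /eqP->.
apply: eq_big => [F|F /andP[FS iF]]; last first.
  rewrite !ffunE iF (_ : F == \top%O = false) ?opprK ?oppr0 ?add0r ?mul1r //.
  by apply: contraNF (link_notin FS) => /eqP->.
apply/andP/and3P => [[FS iF]|[AF FT iF]]; last by rewrite (gap_link fS gS).
split=> //.
  case/orP: (link_cmp FS AS) => // /ltW FA.
  by rewrite (subsetP FA) in iA.
rewrite lt_neqAle lex1 andbT.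
by apply: contraNneq (link_notin FS) => ->.
Qed.

Lemma deg_beta vs S B i : flag S -> (#|S| + (size vs).+1)%N = (mrank M).+1 ->
    B \in S -> (\bot < B)%O ->
    (forall G, G \in S -> G != \bot%O -> (B <= G)%O) ->
    i \in B -> i \notin (\bot%O : flat M) ->
  deg (@beta T M :: vs) S =
  \sum_(F : flat M | [&& (\bot < F)%O, (F < B)%O & i \notin F]) deg vs (F |: S).
Proof.
move=> fS cS BS Bb minB iB ib; have /and3P[_ bS _] := fS.
have gS : gap S \bot%O B.
  split=> // G GS; have [->|Gb] := eqVneq G \bot%O; first by rewrite lexx.
  by rewrite minB ?orbT.
rewrite (deg_flag_interp fS cS (affine_beta_lin M i) (beta_lin_interp minB iB
  ib)).
have nb F : F \in link S -> (F == \bot%O) = false.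
  by move=> FS; apply: contraNF (link_notin FS) => /eqP->.
rewrite (bigID (fun F : flat M => i \notin F)) /= [X in _ + X]big1 ?addr0;
  last first.
  move=> F /andP[FS]; rewrite negbK => iF.
  by rewrite !ffunE iF nb //= subrr mul0r.
apply: eq_big => [F|F /andP[FS /negPf iF]]; last first.
  by rewrite !ffunE iF nb //= oppr0 !sub0r opprK mul1r.
apply/andP/and3P => [[FS iF]|[bF FB iF]]; last by rewrite (gap_link fS gS).
split=> //; first by rewrite lt_def le0x andbT nb.
case/orP: (link_cmp FS BS) => // /ltW BF.
by rewrite (subsetP BF) in iF.
Qed.

(** [alpha] inserts flats only above [A] and [beta] only below [B], so these two members are the
    whole state of the recursion; the part between them is never refined. *)
Definition extremal S B A := [/\ flag S, B \in S, A \in S &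
  [/\ (\bot < B)%O, (A < \top)%O, (B <= A)%O,
      (forall G, G \in S -> G != \bot%O -> (B <= G)%O) &
      (forall G, G \in S -> G != \top%O -> (G <= A)%O)]].

(** Members other than bottom and top have distinct ranks from [rk B] to [rk A]. Against the number
    of remaining factors, this bounds how far an inserted flat can jump. *)
Lemma extremal_card S B A : extremal S B A -> (#|S| + rk B <= rk A + 3)%N.
Proof.
move=> [fS BS AS [bB At BA minB maxA]]; have /and3P[cS bS tS] := fS.
pose S' := S :\ \bot%O :\ \top%O.
have bt : (\bot < \top :> flat M)%O by exact: lt_trans (le_lt_trans BA At).
have cS' : (#|S| = #|S'| + 2)%N.
  rewrite (cardsD1 \bot%O S) bS (cardsD1 \top%O (S :\ _)) in_setD1 tS.
  by rewrite gt_eqF //= add1n add1n addn2.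
pose f G : 'I_(rk A - rk B).+1 := inord (rk G - rk B).
have bnd G : G \in S' -> (rk B <= rk G <= rk A)%N.
  rewrite !in_setD1 => /and3P[GT Gb GS].
  by rewrite !flat_le_rk ?minB ?maxA.
have fE G : G \in S' -> f G = (rk G - rk B)%N :> nat.
  by move=> /bnd h; rewrite inordK //; move: h; clear; lia.
have le_im : (#|f @: S'| <= (rk A - rk B).+1)%N.
  by rewrite -[X in (_ <= X)%N]card_ord max_card.
have card_im : #|f @: S'| = #|S'|.
  apply: card_in_imset => G H GS HS /(congr1 val) /=; rewrite !fE // => e.
  have [GS' HS'] : G \in S /\ H \in S.
    by move: GS HS; rewrite !in_setD1 => /and3P[_ _ ->] /and3P[_ _ ->].
  apply: (chain_rk_inj cS) => //.
  by move: (bnd _ GS) (bnd _ HS) e; clear; lia.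
rewrite cS'; move: le_im (flat_le_rk BA); rewrite card_im; clear; lia.
Qed.

Lemma extremal_top S B A F : extremal S B A -> (A < F)%O -> (F < \top)%O ->
  extremal (F |: S) B F /\ F \in link S.
Proof.
move=> [fS BS AS [bB At BA minB maxA]] AF FT.
have gS : gap S A \top%O.
  split=> //; first by case/and3P: fS.
  move=> G GS; have [->|GT] := eqVneq G \top%O; first by rewrite lexx orbT.
  by rewrite maxA.
have FS := gap_link fS gS AF FT.
split=> //; split; last split; rewrite ?setU11 ?setU1r //.
- exact: link_flag FS.
- exact: le_trans BA (ltW AF).
- move=> G; rewrite in_setU1 => /predU1P[-> _|]; last exact: minB.
  exact: le_trans BA (ltW AF).
move=> G; rewrite in_setU1 => /predU1P[-> _|GS GT]; first by rewrite lexx.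
exact: le_trans (maxA G GS GT) (ltW AF).
Qed.

Lemma extremal_bot S B A F : extremal S B A -> (\bot < F)%O -> (F < B)%O ->
  extremal (F |: S) F A /\ F \in link S.
Proof.
move=> [fS BS AS [bB At BA minB maxA]] bF FB.
have gS : gap S \bot%O B.
  split=> //; first by case/and3P: fS.
  move=> G GS; have [->|Gb] := eqVneq G \bot%O; first by rewrite lexx.
  by rewrite minB ?orbT.
have FS := gap_link fS gS bF FB.
split=> //; split; last split; rewrite ?setU11 ?setU1r //.
- exact: link_flag FS.
- exact: le_trans (ltW FB) BA.
- move=> G; rewrite in_setU1 => /predU1P[-> _|GS Gb]; first by rewrite lexx.
  exact: le_trans (ltW FB) (minB G GS Gb).
move=> G; rewrite in_setU1 => /predU1P[-> _|]; last exact: maxA.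
exact: le_trans (ltW FB) BA.
Qed.

(** Each [alpha] must raise [A] by one rank, in a unique way. The value is 1, stated as [nu B] with
    [rk B = 1] to serve as the start of the induction for [beta]. *)
Lemma deg_alpha_pow j S B A : extremal S B A ->
    (#|S| + j)%N = (mrank M).+1 ->
  deg (nseq j (@alpha T M)) S =
  if (rk B == 1)%N && (j + (rk A).+1 == mrank M)%N then (nu B)%:~R else 0.
Proof.
elim: j S A => [|j IH] S A eS cS; have [fS BS AS [bB At BA minB maxA]] := eS.
  have bt : (\bot < \top :> flat M)%O by exact: lt_trans (le_lt_trans BA At).
  have rM : (0 < mrank M)%N by rewrite -rk_top -lt_bot_rk.
  have full t : (t <= mrank M)%N -> exists2 F, F \in S & rk F = t.
    move=> tr; apply: nmissingP => //; apply/negP => mt.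
    have := card_missing (flag_chain fS); have tr' : (t < (mrank M).+1)%N by [].
    have : (0 < #|[set t : 'I_(mrank M).+1 | missing S t]|)%N.
      by apply/card_gt0P; exists (Ordinal tr'); rewrite inE.
    by move: cS; clear; lia.
  have rB : rk B = 1%N.
    have [C CS rC] := full 1%N rM; apply/eqP; rewrite eqn_leq -lt_bot_rk bB
      andbT.
    rewrite -rC flat_le_rk // minB //.
    by apply/eqP => e; move: rC; rewrite e rk_bot.
  have rA : (rk A).+1 = mrank M.
    have [C CS rC] := full (mrank M).-1 (leq_pred _); apply/eqP.
    rewrite eqn_leq -lt_top_rk At /= -(prednK rM) ltnS -rC flat_le_rk // maxA
      //.
    by apply/eqP => e; move: rC; rewrite e rk_top; move: rM; clear; lia.
  by rewrite /= rB rA add0n !eqxx nu_rk1.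
have [i _ iA] := flat_ltP At.
rewrite [nseq _ _]/= (deg_alpha fS _ AS At maxA iA) ?size_nseq //.
transitivity (\sum_(F : flat M | [&& (A < F)%O, (F < \top)%O & i \in F])
    if (rk B == 1)%N && (j + (rk F).+1 == mrank M)%N then (nu B)%:~R : rat
    else 0).
  apply: eq_bigr => F /and3P[AF FT iF]; have [eF FS] := extremal_top eS AF FT.
  by apply: IH eF _; rewrite (card_link FS) addSnnS.
case: (eqVneq (rk B) 1%N) => [rB|_] /=; last by rewrite big1.
have cA := extremal_card eS.
rewrite -big_mkcondr /=; case: eqP => [e|ne].
  (* By its rank the inserted flat covers [A], and it contains [i], so there is exactly one. *)
  rewrite (big_pred1 (clU A i)) // => F /=.
  have rAi := rk_clU iA.
  apply/andP/eqP => [[/and3P[AF _ iF] /eqP rF]|->].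
    by apply: clU_unique => //; [exact: ltW | move: rF e; clear; lia].
  rewrite lt_clU // in_clU lt_top_rk rAi; split; [apply/andP; split=> //|];
    by move: e; clear; lia.
(* A nonzero term would, by [extremal_card], have [rk F = (rk A).+1], which contradicts [ne]. *)
apply: big1 => F /andP[/and3P[/flat_lt_rk AF _ _] /eqP rF].
by case: ne; move: AF rF cA cS; rewrite rB; clear; lia.
Qed.

(** Each [beta] replaces [B] by the flats it covers that avoid a chosen point [i] of [B], which is
    the recursion [nu_cover]. *)
Lemma deg_beta_alpha_pow k j S B A : extremal S B A ->
    (#|S| + (k + j))%N = (mrank M).+1 ->
  deg (nseq k (@beta T M) ++ nseq j (@alpha T M)) S =
  if (rk B == k.+1)%N && (j + (rk A).+1 == mrank M)%N then (nu B)%:~R else 0.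
Proof.
elim: k S B => [|k IH] S B eS cS; first exact: deg_alpha_pow.
have [fS BS AS [bB At BA minB maxA]] := eS.
have [i iB ib] := flat_ltP bB.
rewrite [nseq _ _ ++ _]/= (deg_beta fS _ BS bB minB iB ib); last first.
  by rewrite size_cat !size_nseq -cS addSn.
transitivity (\sum_(F : flat M | [&& (\bot < F)%O, (F < B)%O & i \notin F])
    if (rk F == k.+1)%N && (j + (rk A).+1 == mrank M)%N then (nu F)%:~R : rat
    else 0).
  apply: eq_bigr => F /and3P[bF FB iF]; have [eF FS] := extremal_bot eS bF FB.
  by apply: IH eF _; rewrite (card_link FS) addSnnS.
case: (eqVneq (j + (rk A).+1)%N (mrank M)) => [e|_]; last first.
  by rewrite andbF big1 // => F _; rewrite andbF.
rewrite andbT; under eq_bigr => F _ do rewrite andbT.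
have cA := extremal_card eS.
rewrite -big_mkcondr /=; case: eqP => [rB|ne].
  rewrite (nu_cover ib iB) rmorph_sum; apply: eq_bigl => F /=.
  apply/andP/and3P => [[/and3P[_ FB iF] /eqP rF]|[FB iF /eqP rF]].
    by rewrite FB iF rF rB.
  have rF' : rk F = k.+1 by move: rF; rewrite rB => -[].
  by rewrite lt_bot_rk rF' FB iF.
apply: big1 => F /andP[/and3P[_ /flat_lt_rk FB _] /eqP rF].
by case: ne; move: FB rF cA cS e; clear; lia.
Qed.

Definition flag0 : {set flat M} := [set \bot%O; \top%O].

Lemma flag0_flag : flag flag0.
Proof.
rewrite /flag set21 set22 !andbT; apply/forall_inP => F _; apply/forall_inP =>
  G.
rewrite in_set2 => /orP[] /eqP->; first by rewrite le0x orbT.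
by rewrite lex1.
Qed.

Lemma extremal_flag0 F : (\bot < F)%O -> (F < \top)%O ->
  extremal (F |: flag0) F F /\ #|F |: flag0| = 3.
Proof.
move=> bF FT; have bt := lt_trans bF FT; have fF : flag (F |: flag0).
  apply: flagU1 flag0_flag _ => G; rewrite in_set2 => /orP[] /eqP->.
    by rewrite le0x orbT.
  by rewrite lex1.
split; last by rewrite cardsU1 in_set2 gt_eqF // lt_eqF //= cards2 lt_eqF.
split; last split; rewrite ?setU11 // => G; rewrite in_setU1 in_set2 =>
  /or3P[]/eqP->;
  by rewrite ?lexx ?le0x ?lex1 ?eqxx.
Qed.

Lemma deg_flag0 i k j : i \notin (\bot%O : flat M) -> (1 < mrank M)%N ->
    (k + j.+1 = mrank M)%N ->
  deg (nseq k (@beta T M) ++ nseq j (@alpha T M)) flag0 =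
  `|(reduced_characteristic_poly M)`_j|%:~R.
Proof.
move=> ib rM kj; rewrite (coef_reduced_characteristic_poly ib); last first.
  by move: kj; clear; lia.
have bt : (\bot < \top :> flat M)%O by rewrite lt_bot_rk rk_top ltnW.
have c0 : #|flag0| = 2%N by rewrite cards2 lt_eqF.
rewrite rmorph_sum /=.
(* The flag bot < top has no proper member to act as [B] or [A], so the first factor is expanded by
   hand; the flat it inserts then plays both roles. Choosing the [i] of the coefficient formula
   matches the two sums. *)
case: k kj => [|k] kj.
  case: j kj => [|j] kj; first by move: kj rM; clear; lia.
  rewrite [nseq _ _ ++ _]/= (@deg_alpha _ _ \bot%O i flag0_flag) ?set21 //;
    first last.
  - by move=> G; rewrite in_set2 => /orP[] /eqP->; rewrite ?lexx // eqxx.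
  - by rewrite size_nseq c0 -kj.
  rewrite (eq_bigr (fun F => if (rk F == 1)%N then 1 else 0)); last first.
    move=> F /and3P[bF FT _]; have [eF cF] := extremal_flag0 bF FT.
    rewrite (deg_alpha_pow eF); last by rewrite cF; move: kj; clear; lia.
    case: eqP => //= rF; rewrite nu_rk1 // rF (_ : _ == _) //.
    by apply/eqP; move: kj; clear; lia.
  rewrite -big_mkcondr /= (big_pred1 (clU \bot%O i)) => [|F /=].
    rewrite (big_pred1 \bot%O) ?nu_bot // => F /=.
    apply/andP/eqP => [[_ /eqP rF]|->]; last by rewrite ib rk_bot -kj.
    apply/esym/flat_le_rk_eq; first exact: le0x.
    by rewrite rk_bot; move: rF kj; clear; lia.
  have rbi := rk_clU ib; rewrite rk_bot in rbi.
  apply/andP/eqP => [[/and3P[bF _ iF] /eqP rF]|->].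
    by apply: clU_unique; rewrite ?rk_bot // ltW.
  by rewrite lt_clU // lt_top_rk rbi in_clU rM.
rewrite [nseq _ _ ++ _]/= (@deg_beta _ _ \top%O i flag0_flag) ?set22 ?inE //;
  first last.
- by move=> G; rewrite in_set2 => /orP[] /eqP->; rewrite ?lexx // eqxx.
- by rewrite size_cat !size_nseq c0 -kj; clear; lia.
rewrite (eq_bigr (fun F => if (rk F == k.+1)%N then (nu F)%:~R else 0));
  last first.
  move=> F /and3P[bF FT _]; have [eF cF] := extremal_flag0 bF FT.
  rewrite (deg_beta_alpha_pow eF); last by rewrite cF; move: kj; clear; lia.
  case: eqP => //= rF; rewrite rF (_ : _ == _) //.
  by apply/eqP; move: kj; clear; lia.
rewrite -big_mkcondr /=; apply: eq_bigl => F; rewrite lt_bot_rk lt_top_rk.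
apply/andP/andP => [[/and3P[_ _ iF] /eqP rF]|[iF /eqP rF]]; rewrite iF; split=>
  //.
- by apply/eqP; move: kj rF; clear; lia.
- by apply/and3P; split=> //; move: kj rF; clear; lia.
by apply/eqP; move: kj rF; clear; lia.
Qed.

End Evaluation.

Theorem theorem4p1 (T : finType) (M : matroid T) (r : nat)
    (rank_M : mrank M = r) (r_ge1 : (1 <= r)%N) (k : nat)
    (k_range : (0 < k < r - 1)%N) :
  let c i := (reduced_characteristic_poly M)`_i in
  `|c (k - 1)%N| * `|c (k + 1)%N| <= `|c k| ^+ 2.
Proof.
pose c i := (reduced_characteristic_poly M)`_i.
suff: `|c (k - 1)%N| * `|c (k + 1)%N| <= `|c k| ^+ 2 by [].
have [u uP] := affine_dual M.
have rM : (1 < mrank M)%N by move: k_range; rewrite rank_M; clear; lia.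
have rM0 := ltnW rM; have bt := flat_bottom_lt_top rM0.
have [i _ ib] := flat_ltP bt.
case: k k_range => // k k_range.
(* Of the r - 1 factors, two vary between [alpha] and [beta]; the common rest [vs] has [k] copies of
   [alpha] and [p] of [beta]. The coefficient in the middle now has index [k.+1]. *)
have [p pr] : exists p, r = (k + p).+3.
  by exists (r - k.+3)%N; move: k_range; clear; lia.
pose al := alpha M; pose be := beta M; pose S := flag0 M.
have fS : flag S := flag0_flag M.
have cS q j : (q + j.+1 = mrank M)%N ->
    (#|S| + size (nseq q be ++ nseq j al))%N = (mrank M).+1.
  by rewrite size_cat !size_nseq cards2 lt_eqF // => <-; clear; lia.
have front q j : (q + j.+2 = mrank M)%N ->
    deg (@flag T M) u (nseq q be ++ nseq j.+1 al) S =
    deg (@flag T M) u (al :: nseq q be ++ nseq j al) S.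
  move=> e; apply: (deg_front (@affine0 T M) (@affineP T M) (@flag_convex T M)
    (u_affine uP) (u_dual uP) (@flag_balance1 T M) _ fS).
  by rewrite -(cS q j.+1 e) !size_cat !size_nseq !addnS.
have E j q : (q + j.+1 = mrank M)%N ->
    deg (@flag T M) u (nseq q be ++ nseq j al) S = `|c j|%:~R.
  by move=> e; rewrite (deg_flag0 uP ib rM e).
pose vs := nseq p be ++ nseq k al.
have e1 : (p + k.+3 = mrank M)%N by rewrite rank_M pr; clear; lia.
have e2 : (p.+1 + k.+2 = mrank M)%N by rewrite -e1; clear; lia.
have e3 : (p.+2 + k.+1 = mrank M)%N by rewrite -e1; clear; lia.
have cvs : (#|S| + (size vs).+2)%N = (mrank M).+1.
  by rewrite -(cS p.+2 k e3).
have vs_convex : {in vs, forall v, weakly_convex (@flag T M) (@affine T M) v}.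
  move=> v; rewrite mem_cat !mem_nseq.
  by case/orP=> /andP[_ /eqP->]; [exact: beta_convex | exact: alpha_convex].
have := deg_log_concave (@affine0 T M) (@affineP T M) (@flag_convex T M)
  (u_affine uP) (u_dual uP) (@flag_balance1 T M) (@flag_pure T M)
  (@flag_connected T M) (flag_lorentz2 uP) al (@neg_card_sq_convex T M)
  (beta_convex rM0) vs_convex fS cvs.
have -> : deg (@flag T M) u (be :: be :: vs) S = `|c k|%:~R.
  by rewrite -(E _ _ e3).
have -> : deg (@flag T M) u (al :: be :: vs) S = `|c k.+1|%:~R.
  by rewrite -(E _ _ e2) front.
have -> : deg (@flag T M) u (al :: al :: vs) S = `|c k.+2|%:~R.
  (* Two copies of [alpha] have to pass the block of [beta]: the second one is moved inside the
     links, after the first has been expanded. *)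
  rewrite -(E _ _ e1) front //; apply: eq_bigr => F FS; congr (_ * _).
  apply/esym/(deg_front (@affine0 T M) (@affineP T M) (@flag_convex T M)
    (u_affine uP) (u_dual uP) (@flag_balance1 T M)); first exact: link_flag FS.
  by rewrite (card_link FS) -cvs !addnS.
by rewrite -intrM -rmorphXn ler_int addn1 subn1 mulrC.
Qed.
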